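(* Let $B\in\mathcal{L}(\mathcal{K},\mathcal{H})$ and $k\in\mathbb{C}$, and suppose there exists $\varepsilon_0>0$ with $k\pm i\varepsilon\in\rho(A_B)$ for all $0<\varepsilon<\varepsilon_0$. Assume the unique continuation hypothesis holds for $\widetilde{A}^*-k$ and $A^*-\overline{k}$, i.e. $\ker(\widetilde{A}^*-k)\cap\ker\Gamma_1\cap\ker\Gamma_2=\{0\}$ and $\ker(A^*-\overline{k})\cap\ker\widetilde{\Gamma}_1\cap\ker\widetilde{\Gamma}_2=\{0\}$. Assume further that the weak limits $$M_B(k\pm i0)g:=\mathrm{w\text{-}}\lim_{\varepsilon\to0}M_B(k\pm i\varepsilon)g$$ exist for every $g\in\mathrm{Ran}(\Gamma_1-B\Gamma_2)$, and that there exists some $f\in\mathrm{Ran}(\Gamma_1-B\Gamma_2)$ such that $M_B(k+i0)f\neq M_B(k-i0)f$. Then $k\in\sigma_{ess}(A_B)$.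
   Context: Setting: $H$ is a complex Hilbert space; $A$ and $\widetilde{A}$ are closed densely defined operators on $H$ forming an adjoint pair, i.e. $A^*\supseteq\widetilde{A}$ and $\widetilde{A}^*\supseteq A$. $D(\widetilde{A}^* )$ and $D(A^* )$ carry their graph norms. A boundary triplet for the pair is fixed: Hilbert spaces $\mathcal{H},\mathcal{K}$ and linear operators $\Gamma_1:D(\widetilde{A}^* )\to\mathcal{H}$, $\Gamma_2:D(\widetilde{A}^* )\to\mathcal{K}$, $\widetilde{\Gamma}_1:D(A^* )\to\mathcal{K}$, $\widetilde{\Gamma}_2:D(A^* )\to\mathcal{H}$, bounded with respect to the graph norms and surjective, such that for $u\in D(\widetilde{A}^* )$, $v\in D(A^* )$ $$(\widetilde{A}^*u,v)_H-(u,A^*v)_H=(\Gamma_1u,\widetilde{\Gamma}_2v)_{\mathcal{H}}-(\Gamma_2u,\widetilde{\Gamma}_1v)_{\mathcal{K}},$$ and $D(A)=D(\widetilde{A}^* )\cap\ker\Gamma_1\cap\ker\Gamma_2$, $D(\widetilde{A})=D(A^* )\cap\ker\widetilde{\Gamma}_1\cap\ker\widetilde{\Gamma}_2$. For $B\in\mathcal{L}(\mathcal{K},\mathcal{H})$ (bounded operators), $A_B:=\widetilde{A}^*|_{\ker(\Gamma_1-B\Gamma_2)}$. For $\lambda\in\rho(A_B)$ the $M$-function $M_B(\lambda):\mathrm{Ran}(\Gamma_1-B\Gamma_2)\to\mathcal{K}$ is the (well-defined) linear operator with $M_B(\lambda)(\Gamma_1-B\Gamma_2)u=\Gamma_2u$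 for all $u\in\ker(\widetilde{A}^*-\lambda)$. The essential spectrum $\sigma_{ess}(A_B)$ consists of all points of the spectrum of $A_B$ that are not isolated eigenvalues of finite (algebraic) multiplicity. *)

(* Defs.v *)
From Stdlib Require Import Reals Lra.
From Coquelicot Require Import Coquelicot.

Set Implicit Arguments.
Unset Strict Implicit.
Unset Printing Implicit Defensive.

Open Scope R_scope.

(* The inner product is linear in its first argument.  Positive definiteness
   follows from [inner_norm] and the norm axioms of Coquelicot. *)
Record HilbertSpace := {
  hilbert_sort :> CompleteNormedModule C_AbsRing;
  inner : hilbert_sort -> hilbert_sort -> C;
  inner_plus_l : forall x y z, inner (plus x y) z = Cplus (inner x z) (inner y z);
  inner_scal_l : forall (a : C) x z, inner (scal a x) z = Cmult a (inner x z);
  inner_conj : forall x y, inner y x = Cconj (inner x y);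
  inner_norm : forall x, inner x x = RtoC (norm x ^ 2)
}.

(* Restriction of scalars to the reals, keeping the norm and the uniform
   structure: Coquelicot's [RInt] only integrates functions with values in a
   real normed module. *)
Section Realification.

Variable V : CompleteNormedModule C_AbsRing.

Definition real_scal (a : R) (x : V) : V := scal (RtoC a) x.

Lemma real_scal_assoc a b x :
  real_scal a (real_scal b x) = real_scal (mult a b) x.
Proof.
unfold real_scal; rewrite scal_assoc; f_equal; symmetry; apply RtoC_mult.
Qed.

Lemma real_scal_one x : real_scal one x = x.
Proof. exact (scal_one x). Qed.

Lemma real_scal_plus_r a x y :
  real_scal a (plus x y) = plus (real_scal a x) (real_scal a y).
Proof. exact (scal_distr_l (RtoC a) x y). Qed.

Lemma real_scal_plus_l a b x :
  real_scal (plus a b) x = plus (real_scal a x) (real_scal b x).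
Proof.
transitivity (scal (plus (RtoC a) (RtoC b) : C_Ring) x).
- unfold real_scal; f_equal; apply RtoC_plus.
- exact (scal_distr_r (RtoC a) (RtoC b) x).
Qed.

Definition real_ModuleSpace_mixin : ModuleSpace.mixin_of R_Ring V :=
  ModuleSpace.Mixin R_Ring V real_scal real_scal_assoc real_scal_one
    real_scal_plus_r real_scal_plus_l.

Definition real_ModuleSpace_class : ModuleSpace.class_of R_Ring V :=
  ModuleSpace.Class R_Ring V (AbelianGroup.class V) real_ModuleSpace_mixin.

Definition real_NormedModuleAux : NormedModuleAux R_AbsRing :=
  NormedModuleAux.Pack R_AbsRing V
    (NormedModuleAux.Class R_AbsRing V real_ModuleSpace_class
       (UniformSpace.class V)) V.

Lemma real_norm_scal (a : R) (x : V) :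
  norm (real_scal a x) <= abs a * norm x.
Proof.
change (abs a) with (Rabs a); rewrite <- Cmod_R; exact (norm_scal (RtoC a) x).
Qed.

Definition real_NormedModule_mixin :
  NormedModule.mixin_of R_AbsRing real_NormedModuleAux :=
  NormedModule.Mixin R_AbsRing real_NormedModuleAux (@norm C_AbsRing V)
    (@norm_factor C_AbsRing V) norm_triangle real_norm_scal
    (@norm_compat1 C_AbsRing V) (@norm_compat2 C_AbsRing V)
    (@norm_eq_zero C_AbsRing V).

Definition realification : CompleteNormedModule R_AbsRing :=
  CompleteNormedModule.Pack R_AbsRing V
    (CompleteNormedModule.Class R_AbsRing V
       (NormedModule.Class R_AbsRing V
          (NormedModuleAux.class R_AbsRing real_NormedModuleAux)
          real_NormedModule_mixin)
       (CompleteSpace.mixin V (CompleteSpace.class V))) V.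

End Realification.

(* A partially defined operator.  [app] is a total function whose values
   outside [dom] are junk: nothing below depends on them. *)
Record operator (U V : Type) := Operator {
  dom : U -> Prop;
  app :> U -> V
}.

Definition linear_on (U V : NormedModule C_AbsRing) (D : U -> Prop) (f : U -> V)
  : Prop :=
  (forall x y, D x -> D y -> f (plus x y) = plus (f x) (f y)) /\
  (forall (a : C) x, D x -> f (scal a x) = scal a (f x)).

Definition maps_onto (U V : Type) (D : U -> Prop) (f : U -> V) : Prop :=
  forall y, exists x, D x /\ f x = y.

Definition operator_restriction (U V : Type) (T : operator U V) (P : U -> Prop)
  : operator U V :=
  Operator (fun u => dom T u /\ P u) T.

Definition extends (U V : Type) (S T : operator U V) : Prop :=
  forall u, dom T u -> dom S u /\ S u = T u.

Section Operators.

Variable H : HilbertSpace.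
Implicit Types (T : operator H H) (lam k : C).

Definition linear_operator T : Prop :=
  dom T zero /\
  (forall x y, dom T x -> dom T y -> dom T (plus x y)) /\
  (forall (a : C) x, dom T x -> dom T (scal a x)) /\
  linear_on (dom T) T.

Definition densely_defined T : Prop :=
  forall (x : H) (eps : posreal), exists u, dom T u /\ ball x eps u.

Definition closed_operator T : Prop :=
  closed (fun p : H * H => dom T (fst p) /\ T (fst p) = snd p).

(* [iota] selects the vector w, which is unique when T is densely defined. *)
Definition adjoint T : operator H H :=
  Operator
    (fun v => exists w, forall u, dom T u -> inner (T u) v = inner u w)
    (fun v => iota (fun w => forall u, dom T u -> inner (T u) v = inner u w)).

Definition graph_norm T (u : H) : R := sqrt (norm u ^ 2 + norm (T u) ^ 2).

Definition graph_bounded (V : HilbertSpace) T (f : H -> V) : Prop :=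
  exists c, forall u, dom T u -> norm (f u) <= c * graph_norm T u.

Definition shift T lam : operator H H :=
  Operator (dom T) (fun u => minus (T u) (scal lam u)).

Definition ker T (u : H) : Prop := dom T u /\ T u = zero.

Definition resolvent_set T lam : Prop :=
  (forall w, exists! u, dom T u /\ shift T lam u = w) /\
  (exists c, forall u, dom T u -> norm u <= c * norm (shift T lam u)).

Definition spectrum T lam : Prop := ~ resolvent_set T lam.

(* (T - lam)^{-1} *)
Definition resolvent T lam (w : H) : H :=
  iota (fun u => dom T u /\ shift T lam u = w).

Definition cis (t : R) : C := (cos t, sin t).

(* - (2 pi i)^{-1} times the contour integral of (T - lam)^{-1} w d lam over
   the positively oriented circle lam = k + r e^{it}, 0 <= t <= 2 pi. *)
Definition riesz_projection T k (r : R) (w : H) : H :=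
  scal (Copp (Cinv (2 * PI * Ci)))
    (RInt (V := realification H)
       (fun t => scal (Ci * r * cis t)%C (resolvent T (k + r * cis t) w))
       0 (2 * PI)).

(* For n = 0 and e = 0 this covers the zero map. *)
Definition finite_rank (P : H -> H) : Prop :=
  exists (n : nat) (e : nat -> H), forall w, exists c : nat -> C,
    P w = sum_n (fun i => scal (c i) (e i)) n.

Definition eigenvalue T lam : Prop :=
  exists u, u <> zero /\ ker (shift T lam) u.

(* The algebraic multiplicity of an isolated point k of the spectrum is the
   rank of its Riesz projection, which is the same for all small circles.  It
   can be infinite although the union of the kernels of (T - k)^n is
   finite-dimensional. *)
Definition isolated_eigenvalue_of_finite_multiplicity T k : Prop :=
  eigenvalue T k /\
  exists r, 0 < r /\
    (forall lam, 0 < Cmod (lam - k) <= r -> resolvent_set T lam) /\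
    finite_rank (riesz_projection T k r).

Definition essential_spectrum T k : Prop :=
  spectrum T k /\ ~ isolated_eigenvalue_of_finite_multiplicity T k.

Definition adjoint_pair (A At : operator H H) : Prop :=
  extends (adjoint A) At /\ extends (adjoint At) A.

End Operators.

(* [At] is the operator written A with a tilde, and likewise for the boundary
   maps; [E] and [F] are the boundary spaces.  The boundary maps on D(At^* )
   and D(A^* ) are total functions with junk values outside these domains. *)
Record boundary_triplet (H E F : HilbertSpace) (A At : operator H H)
    (G1 : H -> E) (G2 : H -> F) (Gt1 : H -> F) (Gt2 : H -> E) : Prop := {
  bt_linear_G1 : linear_on (dom (adjoint At)) G1;
  bt_linear_G2 : linear_on (dom (adjoint At)) G2;
  bt_linear_Gt1 : linear_on (dom (adjoint A)) Gt1;
  bt_linear_Gt2 : linear_on (dom (adjoint A)) Gt2;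
  bt_bounded_G1 : graph_bounded (adjoint At) G1;
  bt_bounded_G2 : graph_bounded (adjoint At) G2;
  bt_bounded_Gt1 : graph_bounded (adjoint A) Gt1;
  bt_bounded_Gt2 : graph_bounded (adjoint A) Gt2;
  bt_onto_G1 : maps_onto (dom (adjoint At)) G1;
  bt_onto_G2 : maps_onto (dom (adjoint At)) G2;
  bt_onto_Gt1 : maps_onto (dom (adjoint A)) Gt1;
  bt_onto_Gt2 : maps_onto (dom (adjoint A)) Gt2;
  bt_green : forall u v, dom (adjoint At) u -> dom (adjoint A) v ->
    (inner (adjoint At u) v - inner u (adjoint A v))%C =
    (inner (G1 u) (Gt2 v) - inner (G2 u) (Gt1 v))%C;
  bt_dom_A : forall u,
    dom A u <-> dom (adjoint At) u /\ G1 u = zero /\ G2 u = zero;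
  bt_dom_At : forall v,
    dom At v <-> dom (adjoint A) v /\ Gt1 v = zero /\ Gt2 v = zero
}.

Section MFunction.

Variables (H E F : HilbertSpace) (At : operator H H).
Variables (G1 : H -> E) (G2 : H -> F) (B : F -> E).

Definition boundary_map (u : H) : E := minus (G1 u) (B (G2 u)).

Definition boundary_range (f : E) : Prop :=
  exists u, dom (adjoint At) u /\ boundary_map u = f.

Definition A_B : operator H H :=
  operator_restriction (adjoint At) (fun u => boundary_map u = zero).

(* For lam in the resolvent set of [A_B] and f in [boundary_range], exactly one
   vector satisfies the condition under [iota]. *)
Definition M_function (lam : C) (f : E) : F :=
  iota (fun g => exists u, ker (shift (adjoint At) lam) u /\
                           boundary_map u = f /\ G2 u = g).

End MFunction.

(* Weak limit of g(eps) as eps decreases to 0. *)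
Definition weak_limit_at_0 (F : HilbertSpace) (g : R -> F) (l : F) : Prop :=
  forall v, filterlim (fun eps => inner (g eps) v) (at_right 0)
                      (locally (inner l v)).

Definition unique_continuation (H E F : HilbertSpace) (T : operator H H)
    (lam : C) (G1 : H -> E) (G2 : H -> F) : Prop :=
  forall u, ker (shift T lam) u -> G1 u = zero -> G2 u = zero -> u = zero.

(* Main.v *)
Require Import Defs.
From Stdlib Require Import Reals Lra List Lia ClassicalEpsilon.
From Coquelicot Require Import Coquelicot.

(** Write R(z) for (A_B - z)^{-1}.  If k is not in the essential spectrum, it
    is a regular point or a pole of R, hence a regular point or a pole of each
    scalar function z |-> (M_B(z) f, v).  A pole is incompatible with a finite
    limit along even one ray, so the function extends analytically to k and
    its limits from above and from below coincide: there can be no jump.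

    The link between M_B and R is the formula
    M_B(z) f = Gamma_2 u + (z - z0) Gamma_2 R(z) u, where u solves
    (At^* - z0) u = 0 with boundary value f ([M_function_resolvent]).  If k is
    regular one takes z0 = k, and the second term tends to zero
    ([M_entry_limit_regular]).

    Suppose now that k is isolated, surrounded by a circle of radius r, and that
    the Riesz projection P of that circle has finite rank.  No contour is ever
    deformed: let S be the average of R over the circle.  Averaging the
    resolvent identity between k + m and the points of the circle gives
    R(k + m) = S + m R(k + m) S + R(k + m) P
    ([averaged_resolvent_identity]).  Since S commutes with P, the kernel of P
    is invariant under S; on it R(k + m) = S + m S R(k + m), which bounds
    R(k + m) near m = 0, and iterating the identity expands it in powers of m
    to any order ([entry_smooth_on_kernel]).

    It remains to pass from the kernel of P to all vectors.  Put L = R(k + r)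
    and N = 1 + r L, which is (A_B - k) L.  The n + 2 vectors
    N^j L^(n+1-j) x have linearly dependent images under P once the range of P
    is spanned by n + 1 vectors, so some nontrivial combination
    z = sum_j a_j N^j L^(n+1-j) x lies in the kernel of P.  As R(k + m) N y and
    m R(k + m) L y differ by a vector independent of m, R(k + m) z is
    (sum_j a_j m^j) R(k + m) L^(n+1) x up to polynomials in m, and the powers
    of L are removed by the resolvent identity.  So a nonzero polynomial times
    R(k + m) x has expansions to all orders at m = 0 ([entry_meromorphic]):
    this is the pole.  Finally, if the polynomial vanishes at 0, the existence
    of a ray limit forces the constant term of the expansion to vanish as well,
    so that a factor m can be cancelled on both sides; after finitely many
    cancellations the common limit can be read off ([ray_limits_agree]). *)

(** * Inner products *)

Section InnerProduct.

Variable H : HilbertSpace.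
Implicit Types x y z : H.

Lemma inner_zero_l z : inner (zero : H) z = 0.
Proof.
replace (zero : H) with (scal (RtoC 0) (zero : H)) by exact (scal_zero_r _).
rewrite inner_scal_l; ring.
Qed.

Lemma inner_opp_l x z : inner (opp x) z = Copp (inner x z).
Proof.
replace (opp x) with (scal (Copp (RtoC 1)) x) by exact (scal_opp_one x).
rewrite inner_scal_l; ring.
Qed.

Lemma inner_minus_l x y z : inner (minus x y) z = Cminus (inner x z) (inner y z).
Proof.
unfold minus; rewrite inner_plus_l, inner_opp_l; reflexivity.
Qed.

Lemma inner_plus_r (x y z : H) : inner x (plus y z) = (inner x y + inner x z)%C.
Proof.
rewrite (inner_conj (plus y z) x), inner_plus_l, Cplus_conj.
rewrite <- !inner_conj; reflexivity.
Qed.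

Lemma inner_scal_r (a : C) x y : inner x (scal a y) = (Cconj a * inner x y)%C.
Proof.
rewrite (inner_conj (scal a y) x), inner_scal_l, Cmult_conj.
rewrite <- (inner_conj y x); reflexivity.
Qed.

Lemma inner_minus_r x y z : inner x (minus y z) = Cminus (inner x y) (inner x z).
Proof.
rewrite (inner_conj (minus y z) x), inner_minus_l, Cminus_conj.
rewrite <- !inner_conj; reflexivity.
Qed.

Lemma inner_self_eq_zero x : inner x x = 0 -> x = zero.
Proof.
rewrite inner_norm; intro Hx; apply (@norm_eq_zero C_AbsRing H).
apply RtoC_inj in Hx.
apply Rsqr_0_uniq; unfold Rsqr; lra.
Qed.

Lemma inner_ext x y : (forall z, inner x z = inner y z) -> x = y.
Proof.
intro Hxy.
assert (Hd : minus x y = zero).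
{ apply inner_self_eq_zero; rewrite inner_minus_l, Hxy; ring. }
apply (plus_reg_r (opp y)); rewrite plus_opp_r; exact Hd.
Qed.

(** For y <> 0 expand the square of the norm of |y|^2 x - (x, y) y, which is
    |y|^2 times the difference of the squares of the two sides. *)
Lemma cauchy_schwarz x y : Cmod (inner x y) <= norm x * norm y.
Proof.
pose proof (norm_ge_0 x) as Hx; pose proof (norm_ge_0 y) as Hy.
destruct (Req_dec (norm y) 0) as [Hy0|Hy0].
- assert (y = zero) as -> by exact (@norm_eq_zero C_AbsRing H y Hy0).
  rewrite inner_conj, Cmod_conj, inner_zero_l, Cmod_0.
  apply Rmult_le_pos; assumption.
- set (w := minus (scal (RtoC (norm y ^ 2)) x) (scal (inner x y) y)).
  assert (Hw : RtoC (norm w ^ 2) =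
               RtoC (norm y ^ 2 * (norm x ^ 2 * norm y ^ 2 - Cmod (inner x y) ^ 2))).
  { rewrite <- inner_norm; unfold w.
    rewrite inner_minus_l, !inner_minus_r, !inner_scal_l, !inner_scal_r.
    rewrite !inner_norm.
    rewrite !RtoC_mult, RtoC_minus, !RtoC_mult.
    rewrite (inner_conj x y), (Cmod2_conj (inner x y)).
    replace (Cconj (norm y ^ 2)%R) with (RtoC (norm y ^ 2))
      by (unfold Cconj; simpl; rewrite Ropp_0; reflexivity).
    ring. }
  apply RtoC_inj in Hw.
  pose proof (pow2_ge_0 (norm w)) as Hw0; rewrite Hw in Hw0.
  assert (0 < norm y ^ 2) by (apply pow_lt; lra).
  assert (0 <= norm x ^ 2 * norm y ^ 2 - Cmod (inner x y) ^ 2) as Hle.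
  { apply Rmult_le_reg_l with (norm y ^ 2); lra. }
  apply Rsqr_incr_0_var;
    [unfold Rsqr; nra | apply Rmult_le_pos; assumption].
Qed.

Lemma norm_plus_le (x y : H) : norm (plus x y) <= norm x + norm y.
Proof. exact (norm_triangle (K := C_AbsRing) (V := H) x y). Qed.

Lemma norm_scal_le (c : C) (x : H) : norm (scal c x) <= Cmod c * norm x.
Proof. exact (norm_scal (K := C_AbsRing) (V := H) c x). Qed.

End InnerProduct.

(** A vector identity holds as soon as it holds against every test vector, and
    there it is an identity of complex numbers. *)
Ltac vector_ring :=
  apply inner_ext; intro;
  repeat first [rewrite inner_plus_l | rewrite inner_minus_l
               | rewrite inner_opp_l | rewrite inner_scal_l
               | rewrite inner_zero_l];
  ring.

(** * Expansions in a punctured neighbourhood of zero *)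

Definition punctured (P : C -> Prop) : Prop :=
  exists d, 0 < d /\ forall m, 0 < Cmod m < d -> P m.

Lemma punctured_and (P Q : C -> Prop) :
  punctured P -> punctured Q -> punctured (fun m => P m /\ Q m).
Proof.
intros [d [Hd HP]] [e [He HQ]]; exists (Rmin d e); split.
- apply Rmin_glb_lt; assumption.
- intros m [Hm Hm']; pose proof (Rmin_l d e); pose proof (Rmin_r d e).
  split; [apply HP | apply HQ]; lra.
Qed.

Lemma punctured_imp (P Q : C -> Prop) :
  (forall m, P m -> Q m) -> punctured P -> punctured Q.
Proof.
intros HPQ [d [Hd HP]]; exists d; split; auto.
Qed.

Lemma punctured_all (P : C -> Prop) : (forall m, P m) -> punctured P.
Proof. intro HP; exists 1; split; [lra | auto]. Qed.

Lemma punctured_lt (d : R) : 0 < d -> punctured (fun m => 0 < Cmod m < d).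
Proof. intro Hd; exists d; split; auto. Qed.

Definition bounded_near_0 (f : C -> C) : Prop :=
  exists M, punctured (fun m => Cmod (f m) <= M).

(** f(m) = c_0 + c_1 m + ... + c_(n-1) m^(n-1) + O(m^n) as m tends to 0.
    Peeling off one term at a time makes the cancellation of a factor m a
    single destructuring step. *)
Fixpoint expansion (n : nat) (f : C -> C) : Prop :=
  match n with
  | O => bounded_near_0 f
  | S n' => exists (c : C) (g : C -> C),
      expansion n' g /\ punctured (fun m => f m = (c + m * g m)%C)
  end.

(** Asymptotic expansions to every order replace analyticity: they are stable
    under the few operations needed, and no power series has to converge. *)
Definition smooth (f : C -> C) : Prop := forall n, expansion n f.

Lemma expansion_ext n f g :
  punctured (fun m => f m = g m) -> expansion n f -> expansion n g.
Proof.
intros Hfg Hf; destruct n as [|n]; simpl in *.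
- destruct Hf as [M HM]; exists M.
  apply (punctured_imp _ _ (fun m Hm => eq_ind _ (fun z => Cmod z <= M)
    (proj1 Hm) _ (proj2 Hm)) (punctured_and _ _ HM Hfg)).
- destruct Hf as [c [h [Hh Hf]]]; exists c, h; split; [exact Hh|].
  eapply punctured_imp; [|exact (punctured_and _ _ Hf Hfg)].
  intros m [H1 H2]; congruence.
Qed.

Lemma expansion_S n : forall f, expansion (S n) f -> expansion n f.
Proof.
induction n as [|n IH]; intros f [c [g [Hg Hf]]].
- destruct Hg as [M HM]; exists (Cmod c + Rmax M 0).
  eapply punctured_imp;
    [|exact (punctured_and _ _ (punctured_and _ _ HM Hf) (punctured_lt 1 Rlt_0_1))].
  intros m [[H1 ->] H2].
  eapply Rle_trans; [apply Cmod_triangle|]; rewrite Cmod_mult.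
  pose proof (Rmax_l M 0); pose proof (Rmax_r M 0).
  pose proof (Cmod_ge_0 (g m)).
  assert (Cmod m * Cmod (g m) <= 1 * Rmax M 0)
    by (apply Rmult_le_compat; lra).
  lra.
- exists c, g; split; [exact (IH g Hg) | exact Hf].
Qed.

Lemma expansion_bounded n f : expansion n f -> bounded_near_0 f.
Proof.
revert f; induction n as [|n IH]; intros f Hf; [exact Hf|].
apply IH, expansion_S, Hf.
Qed.

Lemma expansion_const n (c : C) : expansion n (fun _ => c).
Proof.
revert c; induction n as [|n IH]; intro c.
- exists (Cmod c); apply punctured_all; intro; lra.
- exists c, (fun _ => RtoC 0); split; [apply IH|].
  apply punctured_all; intro; ring.
Qed.

Lemma expansion_plus n : forall f g,
  expansion n f -> expansion n g -> expansion n (fun m => (f m + g m)%C).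
Proof.
induction n as [|n IH]; intros f g.
- intros [M HM] [M' HM']; exists (M + M').
  eapply punctured_imp; [|exact (punctured_and _ _ HM HM')].
  intros m [H1 H2]; eapply Rle_trans; [apply Cmod_triangle|]; lra.
- intros [c [f' [Hf' Hf]]] [c' [g' [Hg' Hg]]].
  exists (c + c')%C, (fun m => (f' m + g' m)%C); split; [auto|].
  eapply punctured_imp; [|exact (punctured_and _ _ Hf Hg)].
  intros m [-> ->]; ring.
Qed.

Lemma expansion_scal n (a : C) : forall f,
  expansion n f -> expansion n (fun m => (a * f m)%C).
Proof.
induction n as [|n IH]; intros f.
- intros [M HM]; exists (Cmod a * M).
  eapply punctured_imp; [|exact HM].
  intros m H1; rewrite Cmod_mult.
  apply Rmult_le_compat_l; [apply Cmod_ge_0 | exact H1].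
- intros [c [f' [Hf' Hf]]]; exists (a * c)%C, (fun m => (a * f' m)%C).
  split; [auto|].
  eapply punctured_imp; [|exact Hf]; intros m ->; ring.
Qed.

Lemma smooth_ext f g :
  smooth f -> punctured (fun m => f m = g m) -> smooth g.
Proof. intros Hf Hfg n; exact (expansion_ext n f g Hfg (Hf n)). Qed.

Lemma smooth_const c : smooth (fun _ => c).
Proof. intro n; apply expansion_const. Qed.

Lemma smooth_plus f g : smooth f -> smooth g -> smooth (fun m => (f m + g m)%C).
Proof. intros Hf Hg n; apply expansion_plus; auto. Qed.

Lemma smooth_scal a f : smooth f -> smooth (fun m => (a * f m)%C).
Proof. intros Hf n; apply expansion_scal; auto. Qed.

Lemma smooth_shift c f : smooth f -> smooth (fun m => (c + m * f m)%C).
Proof.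
intros Hf n; apply expansion_S; exists c, f; split; [apply Hf|].
apply punctured_all; reflexivity.
Qed.

Definition horner (p : list C) (m : C) : C :=
  fold_right (fun a s => (a + m * s)%C) (RtoC 0) p.

Lemma smooth_horner p : smooth (horner p).
Proof.
induction p as [|a p IH]; [exact (smooth_const 0) | exact (smooth_shift a _ IH)].
Qed.

Definition ray_limit (f : C -> C) (u l : C) : Prop :=
  forall e, 0 < e -> at_right 0 (fun x => Cmod (f (u * x)%C - l) < e).

Lemma punctured_at_right (u : C) (P : C -> Prop) :
  u <> 0 -> punctured P -> at_right 0 (fun x : R => P (u * x)%C).
Proof.
intros Hu [d [Hd HP]]; apply Cmod_gt_0 in Hu.
exists (mkposreal _ (Rdiv_lt_0_compat _ _ Hd Hu)); intros x Hx Hx0; simpl in Hx.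
change (Rabs (x - 0) < d / Cmod u) in Hx.
rewrite Rminus_0_r, Rabs_pos_eq in Hx by lra.
apply HP; rewrite Cmod_mult, Cmod_R, (Rabs_pos_eq x) by lra; split.
- apply Rmult_lt_0_compat; lra.
- replace d with (Cmod u * (d / Cmod u)) by (field; lra).
  apply Rmult_lt_compat_l; lra.
Qed.

Lemma Cmod_arbitrarily_small (z : C) (K : R) :
  (forall e, 0 < e <= 1 -> Cmod z <= e * K) -> z = RtoC 0.
Proof.
intro Hle; apply Cmod_eq_0, Rle_antisym; [|apply Cmod_ge_0].
apply Rnot_lt_le; intro Hpos.
set (v := Cmod z) in *.
assert (HK : 0 < K) by (pose proof (Hle 1 ltac:(lra)); lra).
assert (He : 0 < v / (2 * K)) by (apply Rdiv_lt_0_compat; lra).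
assert (HeK : v / (2 * K) * K = v / 2) by (field; lra).
pose proof (Rmin_l 1 (v / (2 * K))); pose proof (Rmin_r 1 (v / (2 * K))).
assert (0 < Rmin 1 (v / (2 * K))) by (apply Rmin_glb_lt; lra).
pose proof (Hle (Rmin 1 (v / (2 * K))) ltac:(lra)).
assert (Rmin 1 (v / (2 * K)) * K <= v / (2 * K) * K)
  by (apply Rmult_le_compat_r; lra).
lra.
Qed.

Lemma ray_limit_value f (u c l : C) M :
  ray_limit f u l -> at_right 0 (fun x : R => Cmod (f (u * x)%C - c) <= M * x) ->
  l = c.
Proof.
intros Hf Hc.
cut ((l - c)%C = RtoC 0).
{ intro Hz; replace l with ((l - c) + c)%C by ring; rewrite Hz; ring. }
apply Cmod_arbitrarily_small with (1 + Rmax M 0); intros e He.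
assert (Hx : at_right 0 (fun x => 0 < x < e)).
{ exists (mkposreal e (proj1 He)); intros x Hx Hx0.
  change (Rabs (x - 0) < e) in Hx; rewrite Rminus_0_r in Hx.
  pose proof (Rle_abs x); lra. }
destruct (filter_ex (F := at_right 0) _
  (filter_and _ _ (Hf e (proj1 He)) (filter_and _ _ Hc Hx))) as [x [H1 [H2 H3]]].
replace (l - c)%C with (- (f (u * x)%C - l) + (f (u * x)%C - c))%C by ring.
eapply Rle_trans; [apply Cmod_triangle|]; rewrite Cmod_opp.
pose proof (Rmax_l M 0); pose proof (Rmax_r M 0).
assert (M * x <= Rmax M 0 * x) by (apply Rmult_le_compat_r; lra).
assert (Rmax M 0 * x <= Rmax M 0 * e) by (apply Rmult_le_compat_l; lra).
lra.
Qed.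

(** With q f and g bounded along the ray, the terms carrying a factor m vanish
    in the limit. *)
Lemma ray_limit_leading f q g (a c u l : C) :
  u <> 0 -> ray_limit f u l -> bounded_near_0 q -> bounded_near_0 g ->
  punctured (fun m => ((a + m * q m) * f m = c + m * g m)%C) ->
  (a * l = c)%C.
Proof.
intros Hu Hf [Mq Hq] [Mg Hg] Heq.
cut ((a * l - c)%C = RtoC 0).
{ intro Hz; replace c with (a * l - (a * l - c))%C by ring; rewrite Hz; ring. }
apply Cmod_arbitrarily_small with (Cmod a + (Mg + Mq * (Cmod l + 1))); intros e He.
destruct (filter_ex (F := at_right 0) _ (filter_and _ _ (Hf e (proj1 He))
  (punctured_at_right u _ Hu (punctured_and _ _ (punctured_and _ _ Hq Hg)
    (punctured_and _ _ Heq (punctured_lt e (proj1 He)))))))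
  as [x [Hlim [[Hqm Hgm] [Hm Hme]]]].
set (m := (u * x)%C) in *.
assert (Hfm : Cmod (f m) <= Cmod l + 1).
{ replace (f m) with ((f m - l) + l)%C by ring.
  eapply Rle_trans; [apply Cmod_triangle|]; lra. }
replace (a * l - c)%C with (- (a * (f m - l)) + m * (g m - q m * f m))%C
  by (replace c with ((a + m * q m) * f m - m * g m)%C by (rewrite Hm; ring);
      ring).
eapply Rle_trans; [apply Cmod_triangle|].
rewrite Cmod_opp, !Cmod_mult, Rmult_plus_distr_l.
apply Rplus_le_compat.
- rewrite Rmult_comm; apply Rmult_le_compat_r; [apply Cmod_ge_0 | lra].
- apply Rmult_le_compat; try apply Cmod_ge_0; [lra|].
  eapply Rle_trans; [apply Cmod_triangle|].
  rewrite Cmod_opp, Cmod_mult; apply Rplus_le_compat; [exact Hgm|].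
  apply Rmult_le_compat; try apply Cmod_ge_0; assumption.
Qed.

(** Induction on p.  If the constant coefficient a of p is nonzero, both limits
    equal c / a, where c is the constant term of the expansion of p f.  If
    a = 0 then c = 0 because f has a finite limit along a ray; dividing by m
    lowers both the length of p and the order of the expansion by one. *)
Lemma ray_limits_agree (p : list C) f (u v l l' : C) :
  Exists (fun a => a <> RtoC 0) p ->
  u <> 0 -> v <> 0 -> ray_limit f u l -> ray_limit f v l' ->
  expansion (length p) (fun m => (horner p m * f m)%C) ->
  l = l'.
Proof.
intros Hp Hu Hv Hl Hl'.
induction p as [|a p IH]; [inversion Hp|].
intros [c [g [Hg Heq]]]; simpl in Heq.
assert (Hgb := expansion_bounded _ _ Hg).
assert (Hq : bounded_near_0 (horner p)) by exact (smooth_horner p 0%nat).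
assert (E1 := ray_limit_leading f (horner p) g a c u l Hu Hl Hq Hgb Heq).
assert (E2 := ray_limit_leading f (horner p) g a c v l' Hv Hl' Hq Hgb Heq).
destruct (excluded_middle_informative (a = RtoC 0)) as [Ha|Ha].
- apply IH.
  + inversion Hp; [contradiction | assumption].
  + clear E2; subst a; rewrite Cmult_0_l in E1; subst c.
    eapply expansion_ext; [|exact Hg].
    eapply punctured_imp; [|exact (punctured_and _ _ Heq (punctured_lt 1 Rlt_0_1))].
    intros m [H1 H2].
    assert (Hm : m <> RtoC 0) by (intro Hm; rewrite Hm, Cmod_0 in H2; lra).
    replace (g m) with (/ m * (0 + m * g m))%C by (field; exact Hm).
    rewrite <- H1; field; exact Hm.
- replace l with (/ a * (a * l))%C by (field; exact Ha).
  rewrite E1, <- E2; field; exact Ha.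
Qed.

(** * Linear dependence *)

Section LinearDependence.

Variable H : HilbertSpace.

Fixpoint lin_comb (a : list C) (xs : list H) : H :=
  match a, xs with
  | c :: a', x :: xs' => plus (scal c x) (lin_comb a' xs')
  | _, _ => zero
  end.

Lemma lin_comb_app a1 : forall a2 xs1 xs2, length a1 = length xs1 ->
  lin_comb (a1 ++ a2) (xs1 ++ xs2) = plus (lin_comb a1 xs1) (lin_comb a2 xs2).
Proof.
induction a1 as [|c a1 IH]; intros a2 [|x xs1] xs2 Hlen; try discriminate; simpl.
- vector_ring.
- rewrite IH by (simpl in Hlen; lia); vector_ring.
Qed.

Lemma linear_map_zero (L : H -> H) : is_linear L -> L (zero : H) = zero.
Proof. exact (linear_zero (K := C_AbsRing) (U := H) (V := H) L). Qed.

Lemma lin_comb_map (L : H -> H) a : is_linear L -> forall xs,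
  lin_comb a (map L xs) = L (lin_comb a xs).
Proof.
intro HL; pose proof (linear_map_zero L HL).
induction a as [|c a IH]; intros [|x xs]; simpl; auto.
rewrite IH, (linear_plus L HL), (linear_scal L HL); reflexivity.
Qed.

(** Recursion on the number of generators exposes the coefficient of the last
    one, which is what elimination removes. *)
Fixpoint in_span (e : nat -> H) (n : nat) (x : H) : Prop :=
  match n with
  | O => x = zero
  | S n' => exists (c : C) (y : H), in_span e n' y /\ x = plus y (scal c (e n'))
  end.

Lemma in_span_sum_n e (c : nat -> C) n :
  in_span e (S n) (sum_n (fun i => scal (c i) (e i)) n).
Proof.
induction n as [|n IH].
- exists (c O), zero; split; [reflexivity|]; rewrite sum_O; vector_ring.
- exists (c (S n)), (sum_n (fun i => scal (c i) (e i)) n); split; [exact IH|].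
  rewrite sum_Sn; reflexivity.
Qed.

Lemma in_span_minus e n : forall (b : C) x y,
  in_span e n x -> in_span e n y -> in_span e n (minus x (scal b y)).
Proof.
induction n as [|n IH]; intros b x y.
- simpl; intros -> ->; vector_ring.
- intros [c [x' [Hx' ->]]] [d [y' [Hy' ->]]].
  exists (c - b * d)%C, (minus x' (scal b y')); split; [auto|]; vector_ring.
Qed.

Definition dependent (xs : list H) : Prop :=
  exists a, length a = length xs /\ Exists (fun c : C => c <> RtoC 0) a /\
    lin_comb a xs = zero.

(** One step of Gaussian elimination: subtracting multiples of x changes any
    linear combination of the vectors by a multiple of x only. *)
Lemma eliminate_pivot e n (x : H) xs :
  List.Forall (fun y : H => exists b : C, in_span e n (minus y (scal b x))) xs ->
  exists ys, length ys = length xs /\ List.Forall (in_span e n) ys /\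
    forall a, exists s, lin_comb a ys = plus (lin_comb a xs) (scal s x).
Proof.
induction 1 as [|y xs [b Hb] _ [ys [Hlen [Hys Hcomb]]]].
- exists nil; repeat split; auto; intro a; exists (RtoC 0).
  destruct a; simpl; vector_ring.
- exists (minus y (scal b x) :: ys); repeat split; simpl; auto.
  intros [|c a]; simpl.
  + exists (RtoC 0); vector_ring.
  + destruct (Hcomb a) as [s Hs]; exists (s - c * b)%C; rewrite Hs; vector_ring.
Qed.

(** If some vector x of the list has a nonzero coefficient on the last
    generator, use it as a pivot to remove that generator from all others. *)
Lemma dependent_of_in_span e n : forall xs,
  length xs = S n -> List.Forall (in_span e n) xs -> dependent xs.
Proof.
induction n as [|n IH]; intros xs Hlen Hxs.
- destruct xs as [|x [|y xs]]; try discriminate.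
  exists (RtoC 1 :: nil); repeat split; [left; exact C1_nz|].
  apply List.Forall_inv in Hxs; simpl in *; rewrite Hxs; vector_ring.
- destruct (excluded_middle_informative (List.Forall (in_span e n) xs)) as [Hn|Hn].
  + destruct xs as [|x xs]; [discriminate|].
    destruct (IH xs) as [a [Ha [Hnz Ha0]]];
      [simpl in Hlen; lia | inversion Hn; assumption|].
    exists (RtoC 0 :: a); repeat split; simpl; auto.
    rewrite Ha0; vector_ring.
  + assert (Hx : exists x, In x xs /\ ~ in_span e n x).
    { apply Classical_Prop.NNPP; intro Hno; apply Hn, List.Forall_forall.
      intros x Hx; apply Classical_Prop.NNPP; intro Hx'; eauto. }
    destruct Hx as [x [Hin Hx]].
    rewrite List.Forall_forall in Hxs.
    assert (Hpiv : exists (c : C) y, c <> RtoC 0 /\ in_span e n y /\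
              x = plus y (scal c (e n))).
    { destruct (Hxs x Hin) as [c [y [Hy Hxy]]]; exists c, y; repeat split; auto.
      intro Hc; apply Hx; rewrite Hxy, Hc.
      replace (plus y (scal (RtoC 0) (e n))) with y by vector_ring; exact Hy. }
    destruct Hpiv as [c [y [Hc [Hy Hxy]]]].
    destruct (in_split _ _ Hin) as [l1 [l2 Hl]].
    destruct (eliminate_pivot e n x (l1 ++ l2)) as [ys [Hylen [Hys Hcomb]]].
    { apply List.Forall_forall; intros z Hz.
      destruct (Hxs z) as [d [z' [Hz' Hzz]]].
      { rewrite Hl; apply in_or_app; apply in_app_or in Hz.
        destruct Hz; [left | right; right]; assumption. }
      exists (d / c)%C.
      replace (minus z (scal (d / c)%C x)) with (minus z' (scal (d / c)%C y));
        [apply in_span_minus; assumption|].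
      rewrite Hzz, Hxy.
      apply inner_ext; intro t.
      rewrite !inner_minus_l, !inner_plus_l, !inner_scal_l, !inner_plus_l,
        !inner_scal_l.
      field; exact Hc. }
    rewrite Hl, length_app in Hlen; simpl in Hlen; rewrite length_app in Hylen.
    destruct (IH ys) as [a [Ha [Hnz Ha0]]]; [lia | exact Hys|].
    destruct (Hcomb a) as [s Hs]; rewrite Ha0 in Hs.
    set (a1 := firstn (length l1) a); set (a2 := skipn (length l1) a).
    assert (Haa : a = a1 ++ a2) by (symmetry; apply firstn_skipn).
    assert (Ha1 : length a1 = length l1).
    { unfold a1; rewrite length_firstn; lia. }
    clearbody a1 a2; subst a xs; rewrite length_app in Ha.
    exists (a1 ++ s :: a2); repeat split.
    * rewrite !length_app; simpl; lia.
    * apply Exists_app in Hnz; apply Exists_app.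
      destruct Hnz; [left | right; right]; assumption.
    * rewrite lin_comb_app by exact Ha1; simpl.
      rewrite lin_comb_app in Hs by exact Ha1.
      rewrite Hs; vector_ring.
Qed.

End LinearDependence.

(** * Integrals of operator families *)

Section OperatorIntegral.

Variable H : HilbertSpace.

(** L is continuous and commutes with Riemann sums. *)
Lemma is_RInt_linear (L : H -> H) (f : R -> H) a b (I : H) :
  is_linear L ->
  is_RInt (V := realification H) f a b I ->
  is_RInt (V := realification H) (fun t => L (f t)) a b (L I).
Proof.
intros HL Hf.
assert (Hreal : forall (c : R) (x : H),
  L (scal (V := realification H) c x) = scal (V := realification H) c (L x)).
{ intros c x; exact (linear_scal L HL (RtoC c) x). }
assert (Hsum : forall s, Riemann_sum (V := realification H) (fun t => L (f t)) s =
                         L (Riemann_sum (V := realification H) f s)).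
{ intro s; induction s as [x0|h s IH] using SF_cons_ind.
  - unfold Riemann_sum; simpl.
    symmetry; exact (linear_map_zero H L HL).
  - rewrite !Riemann_sum_cons, IH, <- Hreal.
    symmetry; apply (linear_plus L HL). }
unfold is_RInt in *.
apply filterlim_ext with (fun s => L (scal (V := realification H) (sign (b - a))
  (Riemann_sum (V := realification H) f s))).
- intro s; rewrite Hsum; apply Hreal.
- eapply filterlim_comp; [exact Hf|].
  exact (linear_cont (K := C_AbsRing) (U := H) (V := H) L I HL).
Qed.

Variables (U : R -> H -> H) (a b M : R).
Hypothesis a_le_b : a <= b.
Hypothesis U_linear : forall t, is_linear (U t).
Hypothesis U_bounded : forall t x, a <= t <= b -> norm (U t x) <= M * norm x.
Hypothesis U_continuous :
  forall x t, continuous (U := realification H) (fun s => U s x) t.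

Definition op_RInt (x : H) : H :=
  RInt (V := realification H) (fun t => U t x) a b.

Lemma op_RInt_correct x :
  is_RInt (V := realification H) (fun t => U t x) a b (op_RInt x).
Proof.
apply (RInt_correct (V := realification H)).
apply (ex_RInt_continuous (V := realification H)); intros t _; apply U_continuous.
Qed.

Lemma op_RInt_commute (L : H -> H) x :
  is_linear L -> (forall t y, L (U t y) = U t (L y)) ->
  L (op_RInt x) = op_RInt (L x).
Proof.
intros HL Hcomm; symmetry; apply (is_RInt_unique (V := realification H)).
apply (is_RInt_ext (V := realification H) (fun t => L (U t x))).
- intros t _; apply Hcomm.
- apply is_RInt_linear; [exact HL | apply op_RInt_correct].
Qed.

Lemma op_RInt_linear : is_linear op_RInt.
Proof.
split.
- intros x y; apply (is_RInt_unique (V := realification H)).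
  apply (is_RInt_ext (V := realification H)
           (fun t => plus (U t x) (U t y))).
  + intros t _; symmetry; apply (linear_plus _ (U_linear t)).
  + exact (is_RInt_plus (V := realification H) _ _ _ _ _ _
             (op_RInt_correct x) (op_RInt_correct y)).
- intros c x; symmetry.
  exact (op_RInt_commute (scal c) x (is_linear_scal_r c Cmult_comm)
           (fun t y => eq_sym (linear_scal _ (U_linear t) c y))).
- assert (0 <= Rmax M 0) by apply Rmax_r.
  exists ((b - a) * Rmax M 0 + 1); split.
  + assert (0 <= (b - a) * Rmax M 0) by (apply Rmult_le_pos; lra); lra.
  + intro x; pose proof (norm_ge_0 x).
    apply Rle_trans with ((b - a) * (Rmax M 0 * norm x)); [|nra].
    apply (norm_RInt_le_const (V := realification H) (fun t => U t x) a b);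
      [exact a_le_b| |apply op_RInt_correct].
    intros t Ht; apply Rle_trans with (1 := U_bounded t x Ht).
    apply Rmult_le_compat_r; [assumption | apply Rmax_l].
Qed.

End OperatorIntegral.

(** * Resolvents *)

Section Resolvent.

Variables (H : HilbertSpace) (T : operator H H).
Hypothesis T_linear : linear_operator T.

Lemma resolvent_spec (lam : C) w : resolvent_set T lam ->
  dom T (resolvent T lam w) /\ shift T lam (resolvent T lam w) = w.
Proof. intros [Hex _]; exact (iota_correct _ (Hex w)). Qed.

Lemma resolvent_dom (lam : C) w : resolvent_set T lam -> dom T (resolvent T lam w).
Proof. intro Hl; apply (resolvent_spec _ w Hl). Qed.

Lemma app_resolvent (lam : C) w : resolvent_set T lam ->
  T (resolvent T lam w) = plus w (scal lam (resolvent T lam w)).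
Proof.
intro Hl; destruct (resolvent_spec _ w Hl) as [_ Hw]; unfold shift in Hw.
simpl in Hw; rewrite <- Hw at 2; vector_ring.
Qed.

Lemma resolvent_unique (lam : C) u w : resolvent_set T lam ->
  dom T u -> shift T lam u = w -> u = resolvent T lam w.
Proof.
intros Hl Hu Hw.
destruct (resolvent_spec lam w Hl) as [Hd Hs].
destruct Hl as [Hex _]; destruct (Hex w) as [v [_ Hv]].
rewrite <- (Hv u (conj Hu Hw)); apply Hv; auto.
Qed.

Lemma resolvent_linear (lam : C) :
  resolvent_set T lam -> is_linear (resolvent T lam).
Proof.
intro Hl; destruct T_linear as [_ [Dplus [Dscal [Tplus Tscal]]]].
split.
- intros x y; symmetry.
  destruct (resolvent_spec lam x Hl) as [Dx Ex].
  destruct (resolvent_spec lam y Hl) as [Dy Ey].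
  apply resolvent_unique; auto.
  unfold shift in *; simpl in *; rewrite Tplus by assumption.
  rewrite <- Ex at 3; rewrite <- Ey at 3; vector_ring.
- intros c x; symmetry.
  destruct (resolvent_spec lam x Hl) as [Dx Ex].
  apply resolvent_unique; auto.
  unfold shift in *; simpl in *; rewrite Tscal by assumption.
  rewrite <- Ex at 3; vector_ring.
- destruct (proj2 Hl) as [c Hc]; exists (Rabs c + 1); split.
  + pose proof (Rabs_pos c); lra.
  + intro x; destruct (resolvent_spec lam x Hl) as [Dx Ex].
    specialize (Hc _ Dx); rewrite Ex in Hc.
    apply Rle_trans with (1 := Hc); apply Rmult_le_compat_r; [apply norm_ge_0|].
    pose proof (Rle_abs c); lra.
Qed.

(** The right-hand side solves the equation that defines the left-hand side. *)
Lemma resolvent_identity (lam mu : C) w :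
  resolvent_set T lam -> resolvent_set T mu ->
  resolvent T lam w =
  plus (resolvent T mu w)
    (scal (lam - mu)%C (resolvent T lam (resolvent T mu w))).
Proof.
intros Hl Hm; destruct T_linear as [_ [Dplus [Dscal [Tplus Tscal]]]].
symmetry; apply resolvent_unique; [exact Hl| |].
- apply Dplus; [|apply Dscal]; apply resolvent_dom; assumption.
- unfold shift; simpl.
  rewrite Tplus, Tscal by (try apply Dscal; apply resolvent_dom; assumption).
  rewrite !app_resolvent by assumption; vector_ring.
Qed.

Lemma resolvent_commute (lam mu : C) w :
  resolvent_set T lam -> resolvent_set T mu ->
  resolvent T lam (resolvent T mu w) = resolvent T mu (resolvent T lam w).
Proof.
intros Hl Hm.
destruct (excluded_middle_informative (lam = mu)) as [->|Hne]; [reflexivity|].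
assert (Hz : (lam - mu)%C <> RtoC 0) by exact (Cminus_eq_contra _ _ Hne).
pose proof (resolvent_identity lam mu w Hl Hm) as E1.
pose proof (resolvent_identity mu lam w Hm Hl) as E2.
apply inner_ext; intro t.
apply (f_equal (fun x => inner x t)) in E1, E2.
rewrite inner_plus_l, inner_scal_l in E1, E2.
set (a := inner (resolvent T lam w) t) in *.
set (b := inner (resolvent T mu w) t) in *.
set (x := inner (resolvent T lam (resolvent T mu w)) t) in *.
set (y := inner (resolvent T mu (resolvent T lam w)) t) in *.
replace x with (/ (lam - mu) * ((lam - mu) * x))%C by (field; exact Hz).
replace y with (/ (lam - mu) * ((lam - mu) * y))%C by (field; exact Hz).
f_equal.
transitivity (b + (lam - mu) * x - b)%C; [ring|].
rewrite <- E1, E2; ring.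
Qed.

(** From R(mu) = R(lam) + (mu - lam) R(lam) R(mu), the last term being at most
    half of R(mu), it can be absorbed in the left-hand side. *)
Lemma resolvent_bound_near (lam mu : C) (c : R) :
  resolvent_set T lam -> resolvent_set T mu ->
  (forall x, norm (resolvent T lam x) <= c * norm x) ->
  Cmod (mu - lam) * c <= / 2 ->
  forall x, norm (resolvent T mu x) <= 2 * c * norm x.
Proof.
intros Hl Hm Hc Hsmall x.
assert (E : resolvent T mu x = plus (resolvent T lam x)
              (scal (mu - lam)%C (resolvent T lam (resolvent T mu x)))).
{ rewrite resolvent_commute by assumption; apply resolvent_identity; assumption. }
pose proof (norm_plus_le H (resolvent T lam x)
  (scal (mu - lam)%C (resolvent T lam (resolvent T mu x)))) as Ht.
rewrite <- E in Ht.
pose proof (norm_scal_le H (mu - lam) (resolvent T lam (resolvent T mu x))).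
pose proof (Hc x); pose proof (Hc (resolvent T mu x)).
assert (Cmod (mu - lam) * norm (resolvent T lam (resolvent T mu x)) <=
        Cmod (mu - lam) * (c * norm (resolvent T mu x)))
  by (apply Rmult_le_compat_l; [apply Cmod_ge_0 | assumption]).
assert (Cmod (mu - lam) * c * norm (resolvent T mu x) <=
        / 2 * norm (resolvent T mu x))
  by (apply Rmult_le_compat_r; [apply norm_ge_0 | assumption]).
lra.
Qed.

Section Path.

Variables (zeta : R -> C) (K : R).
Hypothesis K_ge_0 : 0 <= K.
Hypothesis zeta_lipschitz : forall s t, Cmod (zeta s - zeta t) <= K * Rabs (s - t).
Hypothesis zeta_regular : forall t, resolvent_set T (zeta t).

(** The radius of the neighbourhood is tied to the bound by the equation, so
    that a positive lower bound for the radii bounds the resolvents. *)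
Lemma path_local_bound t :
  { cd : R * posreal | 0 < fst cd /\ snd cd * (2 * (K + 1) * fst cd) = 1 /\
      forall s, Rabs (s - t) < snd cd ->
      forall x, norm (resolvent T (zeta s) x) <= 2 * fst cd * norm x }.
Proof.
apply constructive_indefinite_description.
destruct (linear_norm _ (resolvent_linear _ (zeta_regular t))) as [c [Hc Hb]].
assert (Hp : 0 < 2 * (K + 1) * c)
  by (apply Rmult_lt_0_compat; [lra | exact Hc]).
exists (c, mkposreal _ (Rinv_0_lt_compat _ Hp)); simpl.
split; [exact Hc|]; split.
- apply Rinv_l; lra.
- intros s Hs; apply (resolvent_bound_near (zeta t)); auto.
  apply Rle_trans with ((K + 1) * / (2 * (K + 1) * c) * c).
  + apply Rmult_le_compat_r; [lra|].
    apply Rle_trans with (1 := zeta_lipschitz s t).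
    apply Rmult_le_compat; try lra; apply Rabs_pos.
  + right; field; lra.
Qed.

(** Compactness of [a, b] gives a common lower bound d for the radii of
    [path_local_bound], hence the common bound 1 / d. *)
Lemma path_bound a b :
  exists M, forall t x, a <= t <= b ->
    norm (resolvent T (zeta t) x) <= M * norm x.
Proof.
set (delta := fun t => snd (proj1_sig (path_local_bound t))).
destruct (compactness_value_1d a b delta) as [d Hd].
exists (/ d); intros t x Ht.
destruct (Classical_Prop.NNPP _ (Hd t Ht)) as [s [_ [Hs Hds]]].
unfold delta in *; destruct (path_local_bound s) as [[c e] [Hc [Hce Hb]]]; simpl in *.
apply Rle_trans with (1 := Hb t Hs x).
apply Rmult_le_compat_r; [apply norm_ge_0|].
pose proof (cond_pos d); pose proof (cond_pos e).
apply Rmult_le_reg_l with d; [assumption|]; rewrite Rinv_r by lra.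
assert (d * (2 * c) <= e * (2 * c)) by (apply Rmult_le_compat_r; lra).
assert (0 <= K * (e * (2 * c))).
{ apply Rmult_le_pos; [assumption|]; apply Rmult_le_pos; lra. }
lra.
Qed.

Lemma path_continuous x t :
  continuous (U := realification H) (fun s => resolvent T (zeta s) x) t.
Proof.
destruct (path_local_bound t) as [[c e] [Hc [Hce Hb]]]; simpl in *.
set (y := resolvent T (zeta t) x).
apply (filterlim_locally (F := locally t) (U := realification H)); intro eps.
pose proof (cond_pos e); pose proof (cond_pos eps).
pose proof (norm_ge_0 y) as Hy.
set (D := K * (2 * c * norm y) + 1).
assert (HD : 0 < D).
{ unfold D; assert (0 <= K * (2 * c * norm y)); [|lra].
  apply Rmult_le_pos; [assumption|]; apply Rmult_le_pos; lra. }
assert (Hr : 0 < Rmin e (eps / D)).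
{ apply Rmin_glb_lt; [assumption|]; apply Rdiv_lt_0_compat; assumption. }
exists (mkposreal _ Hr); intros s Hs.
change (Rabs (s - t) < Rmin e (eps / D)) in Hs.
pose proof (Rmin_l e (eps / D)); pose proof (Rmin_r e (eps / D)).
apply (norm_compat1 (V := realification H)).
change (norm (minus (resolvent T (zeta s) x) y : H) < eps).
assert (E : minus (resolvent T (zeta s) x) y =
            scal (zeta s - zeta t)%C (resolvent T (zeta s) y)).
{ rewrite (resolvent_identity (zeta s) (zeta t) x) by auto.
  fold y; vector_ring. }
rewrite E.
apply Rle_lt_trans with (1 := norm_scal_le H _ _).
apply Rle_lt_trans with (K * Rabs (s - t) * (2 * c * norm y)).
- apply Rmult_le_compat; try apply Cmod_ge_0; try apply norm_ge_0;
    [apply zeta_lipschitz | apply Hb; lra].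
- apply Rle_lt_trans with (D * Rabs (s - t)).
  + unfold D; pose proof (Rabs_pos (s - t)); nra.
  + replace (pos eps) with (D * (eps / D)) by (field; lra).
    apply Rmult_lt_compat_l; lra.
Qed.

End Path.

End Resolvent.

Lemma Cmod_Ci : Cmod Ci = 1.
Proof.
unfold Cmod, Ci; simpl.
replace (0 * (0 * 1) + 1 * (1 * 1)) with 1 by ring; apply sqrt_1.
Qed.

Lemma cis_lipschitz s t : Cmod (cis s - cis t) <= 2 * Rabs (s - t).
Proof.
assert (Hlip : forall f df : R -> R, (forall x, is_derive f x (df x)) ->
                 (forall x, -1 <= df x <= 1) -> Rabs (f s - f t) <= Rabs (s - t)).
{ intros f df Hf Hdf.
  destruct (MVT_gen f t s df) as [c [_ ->]].
  - intros x _; apply Hf.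
  - intros x _; apply continuity_pt_filterlim, (ex_derive_continuous f x).
    exists (df x); apply Hf.
  - pose proof (Rabs_pos (s - t)); pose proof (Rabs_le _ _ (Hdf c)).
    rewrite Rabs_mult; apply Rle_trans with (1 * Rabs (s - t)); [|lra].
    apply Rmult_le_compat_r; assumption. }
replace (cis s - cis t)%C with (RtoC (cos s - cos t) + Ci * RtoC (sin s - sin t))%C
  by (unfold cis; apply injective_projections; simpl; ring).
eapply Rle_trans; [apply Cmod_triangle|].
rewrite Cmod_mult, !Cmod_R.
rewrite Cmod_Ci.
assert (Rabs (cos s - cos t) <= Rabs (s - t)).
  { apply (Hlip cos (fun x => - sin x)); [apply is_derive_cos|].
    intro x; pose proof (SIN_bound x); lra. }
assert (Rabs (sin s - sin t) <= Rabs (s - t)).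
  { apply (Hlip sin cos); [apply is_derive_sin | apply COS_bound]. }
lra.
Qed.

Lemma Cmod_cis t : Cmod (cis t) = 1.
Proof.
unfold Cmod, cis; simpl; pose proof (sin2_cos2 t) as Hsc; unfold Rsqr in Hsc.
replace (cos t * (cos t * 1) + sin t * (sin t * 1)) with 1 by lra.
apply sqrt_1.
Qed.

(** * Resolvents around an isolated point *)

Lemma functional_resolvent_bound (H : HilbertSpace) (T : operator H H)
    (phi : H -> C) (c M K : R) (lam : C) (x : H) :
  0 <= c ->
  (forall u, dom T u -> Cmod (phi u) <= c * (norm u + norm (T u))) ->
  resolvent_set T lam ->
  norm (resolvent T lam x) <= M -> Cmod lam <= K ->
  Cmod (phi (resolvent T lam x)) <= c * (M + (norm x + K * M)).
Proof.
intros Hc Hphi Hl HM HK.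
apply Rle_trans with (1 := Hphi _ (resolvent_dom H T _ x Hl)).
apply Rmult_le_compat_l; [exact Hc|].
apply Rplus_le_compat; [exact HM|].
rewrite app_resolvent by exact Hl.
eapply Rle_trans; [apply norm_plus_le|]; apply Rplus_le_compat_l.
eapply Rle_trans; [apply norm_scal_le|].
apply Rmult_le_compat; auto using Cmod_ge_0, norm_ge_0.
Qed.

Section IsolatedPoint.

Variables (H : HilbertSpace) (T : operator H H).
Hypothesis T_linear : linear_operator T.
Variables (k : C) (r : R).
Hypothesis r_pos : 0 < r.
Hypothesis regular : forall lam : C, 0 < Cmod (lam - k) <= r -> resolvent_set T lam.

Definition circle (t : R) : C := (k + r * cis t)%C.

Lemma Cmod_circle t : Cmod (circle t - k) = r.
Proof.
unfold circle; replace (k + r * cis t - k)%C with (r * cis t)%C by ring.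
rewrite Cmod_mult, Cmod_R, Cmod_cis, Rabs_pos_eq by lra; ring.
Qed.

Lemma circle_regular t : resolvent_set T (circle t).
Proof. apply regular; rewrite Cmod_circle; lra. Qed.

Lemma circle_lipschitz s t : Cmod (circle s - circle t) <= r * 2 * Rabs (s - t).
Proof.
unfold circle.
replace (k + r * cis s - (k + r * cis t))%C with (r * (cis s - cis t))%C by ring.
rewrite Cmod_mult, Cmod_R, Rabs_pos_eq by lra.
rewrite Rmult_assoc; apply Rmult_le_compat_l; [lra | apply cis_lipschitz].
Qed.

Lemma two_r_ge_0 : 0 <= r * 2. Proof. lra. Qed.

Definition circle_resolvent (t : R) (x : H) : H := resolvent T (circle t) x.

Definition weighted_resolvent (t : R) (x : H) : H :=
  scal (Ci * r * cis t)%C (resolvent T (circle t) x).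

Lemma Cmod_weight t : Cmod (Ci * r * cis t) = r.
Proof.
rewrite !Cmod_mult, Cmod_R, Cmod_cis, Cmod_Ci, Rabs_pos_eq by lra; ring.
Qed.

Lemma circle_resolvent_linear t : is_linear (circle_resolvent t).
Proof. exact (resolvent_linear H T T_linear _ (circle_regular t)). Qed.

Lemma weighted_resolvent_linear t : is_linear (weighted_resolvent t).
Proof.
exact (is_linear_comp _ _ (circle_resolvent_linear t)
         (is_linear_scal_r (V := H) (Ci * r * cis t)%C Cmult_comm)).
Qed.

Lemma circle_resolvent_bound : exists M, forall t x, 0 <= t <= 2 * PI ->
  norm (circle_resolvent t x) <= M * norm x.
Proof.
exact (path_bound H T T_linear circle (r * 2) two_r_ge_0 circle_lipschitz
         circle_regular 0 (2 * PI)).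
Qed.

Lemma weighted_resolvent_bound : exists M, forall t x, 0 <= t <= 2 * PI ->
  norm (weighted_resolvent t x) <= M * norm x.
Proof.
destruct circle_resolvent_bound as [M HM]; exists (r * M); intros t x Ht.
apply Rle_trans with (1 := norm_scal_le H _ _); rewrite Cmod_weight, Rmult_assoc.
apply Rmult_le_compat_l; [lra | exact (HM t x Ht)].
Qed.

Lemma circle_resolvent_continuous x t :
  continuous (U := realification H) (fun s => circle_resolvent s x) t.
Proof.
exact (path_continuous H T T_linear circle (r * 2) two_r_ge_0 circle_lipschitz
         circle_regular x t).
Qed.

Lemma weighted_resolvent_continuous x t :
  continuous (U := realification H) (fun s => weighted_resolvent s x) t.
Proof.
apply (continuous_scal (U := R_UniformSpace) (K := C_AbsRing) (V := H)
         (fun s => (Ci * r * cis s)%C) (fun s => circle_resolvent s x) t);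
  [|exact (circle_resolvent_continuous x t)].
apply (filterlim_locally (F := locally t) (U := AbsRing_UniformSpace C_AbsRing)).
intro eps; pose proof (cond_pos eps).
assert (Hd : 0 < eps / (r * 2)) by (apply Rdiv_lt_0_compat; lra).
exists (mkposreal _ Hd); intros s Hs.
change (Rabs (s - t) < eps / (r * 2)) in Hs.
change (Cmod (Ci * r * cis s - Ci * r * cis t) < eps).
replace (Ci * r * cis s - Ci * r * cis t)%C with (Ci * (circle s - circle t))%C
  by (unfold circle; ring).
rewrite Cmod_mult, Cmod_Ci, Rmult_1_l.
apply Rle_lt_trans with (1 := circle_lipschitz s t).
replace (pos eps) with (r * 2 * (eps / (r * 2))) by (field; lra).
apply Rmult_lt_compat_l; lra.
Qed.

Definition circle_integral : H -> H := op_RInt H circle_resolvent 0 (2 * PI).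
Definition weighted_integral : H -> H := op_RInt H weighted_resolvent 0 (2 * PI).

Lemma riesz_projection_weighted w :
  riesz_projection T k r w =
  scal (Copp (Cinv (2 * PI * Ci))) (weighted_integral w).
Proof. reflexivity. Qed.

Lemma two_PI_ge_0 : 0 <= 2 * PI.
Proof. pose proof PI_RGT_0; lra. Qed.

Lemma circle_integral_linear : is_linear circle_integral.
Proof.
destruct circle_resolvent_bound as [M HM].
exact (op_RInt_linear H circle_resolvent 0 (2 * PI) M two_PI_ge_0
         circle_resolvent_linear HM circle_resolvent_continuous).
Qed.

Lemma weighted_integral_linear : is_linear weighted_integral.
Proof.
destruct weighted_resolvent_bound as [M HM].
exact (op_RInt_linear H weighted_resolvent 0 (2 * PI) M two_PI_ge_0
         weighted_resolvent_linear HM weighted_resolvent_continuous).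
Qed.

Lemma circle_integral_commute (lam : C) x : resolvent_set T lam ->
  resolvent T lam (circle_integral x) = circle_integral (resolvent T lam x).
Proof.
intro Hl.
apply (op_RInt_commute H circle_resolvent 0 (2 * PI) circle_resolvent_continuous).
- exact (resolvent_linear H T T_linear lam Hl).
- intros t y; apply resolvent_commute; auto; apply circle_regular.
Qed.

Lemma integrals_commute x :
  circle_integral (weighted_integral x) = weighted_integral (circle_integral x).
Proof.
apply (op_RInt_commute H weighted_resolvent 0 (2 * PI)
         weighted_resolvent_continuous); [exact circle_integral_linear|].
intros t y; unfold weighted_resolvent.
rewrite (linear_scal _ circle_integral_linear).
rewrite <- circle_integral_commute by apply circle_regular; reflexivity.
Qed.

(** Integrate over the circle the resolvent identity
    R(k + m) x = R(c) x + (k + m - c) R(k + m) R(c) x at c = k + r e^(it),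
    with k + m - c = m + i (i r e^(it)). *)
Lemma averaged_resolvent_identity (m : C) x : resolvent_set T (k + m)%C ->
  scal (RtoC (2 * PI)) (resolvent T (k + m)%C x) =
  plus (circle_integral x)
    (resolvent T (k + m)%C
       (plus (scal m (circle_integral x)) (scal Ci (weighted_integral x)))).
Proof.
intro Hl.
assert (HL := resolvent_linear H T T_linear _ Hl).
assert (Hc := op_RInt_correct H circle_resolvent 0 (2 * PI)
                circle_resolvent_continuous x).
assert (Hw := op_RInt_correct H weighted_resolvent 0 (2 * PI)
                weighted_resolvent_continuous x).
assert (HLc := is_RInt_linear H _ _ _ _ _ (is_linear_comp _ _
  (is_linear_scal_r (V := H) m Cmult_comm) HL) Hc).
assert (HLw := is_RInt_linear H _ _ _ _ _ (is_linear_comp _ _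
  (is_linear_scal_r (V := H) Ci Cmult_comm) HL) Hw).
assert (Hsum := is_RInt_plus (V := realification H) _ _ _ _ _ _ Hc
  (is_RInt_plus (V := realification H) _ _ _ _ _ _ HLc HLw)).
assert (Hconst := is_RInt_const (V := realification H) 0 (2 * PI)
  (resolvent T (k + m)%C x)).
rewrite (linear_plus _ HL).
apply (is_RInt_unique (V := realification H)) in Hsum.
rewrite Rminus_0_r in Hconst.
apply (is_RInt_unique (V := realification H)) in Hconst.
refine (eq_trans (eq_sym Hconst) (eq_trans _ Hsum)).
apply (RInt_ext (V := realification H)); intros t _.
change (resolvent T (k + m)%C x =
  plus (circle_resolvent t x) (plus
    (resolvent T (k + m)%C (scal m (circle_resolvent t x)))
    (resolvent T (k + m)%C (scal Ci (weighted_resolvent t x)))) :> H).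
unfold circle_resolvent, weighted_resolvent.
rewrite !(linear_scal _ HL).
rewrite (resolvent_identity H T T_linear _ (circle t) x Hl (circle_regular t)) at 1.
replace (k + m - circle t)%C with (m + Ci * (Ci * r * cis t))%C
  by (unfold circle; replace (Ci * (Ci * r * cis t))%C with ((Ci * Ci) * (r * cis t))%C
        by ring; replace (Ci * Ci)%C with (Copp (RtoC 1))
        by (unfold Ci; apply injective_projections; simpl; ring); ring).
vector_ring.
Qed.

(** In the variable z = k + r e^(it) this is (2 pi i)^{-1} times the contour
    integral of (z - k)^{-1} (T - z)^{-1} dz, the constant term of the Laurent
    series of the resolvent at k. *)
Definition regular_part (x : H) : H :=
  scal (RtoC (/ (2 * PI))) (circle_integral x).

Lemma regular_part_linear : is_linear regular_part.
Proof.
exact (is_linear_comp _ _ circle_integral_linear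
         (is_linear_scal_r (V := H) (RtoC (/ (2 * PI))) Cmult_comm)).
Qed.

Lemma resolvent_on_kernel (m : C) z : resolvent_set T (k + m)%C ->
  weighted_integral z = zero ->
  resolvent T (k + m)%C z =
  plus (regular_part z) (scal m (resolvent T (k + m)%C (regular_part z))).
Proof.
intros Hl Hz.
assert (HL := resolvent_linear H T T_linear _ Hl).
pose proof (averaged_resolvent_identity m z Hl) as E.
rewrite Hz, (linear_plus _ HL), !(linear_scal _ HL), (linear_map_zero H _ HL) in E.
unfold regular_part; rewrite (linear_scal _ HL).
assert (Hpi : RtoC (2 * PI) <> RtoC 0).
{ intro Hpi; apply RtoC_inj in Hpi; pose proof PI_RGT_0; lra. }
rewrite RtoC_inv by (pose proof PI_RGT_0; lra).
apply inner_ext; intro t.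
apply (f_equal (fun y => inner y t)) in E.
rewrite !inner_plus_l, !inner_scal_l, inner_zero_l in E.
rewrite !inner_plus_l, !inner_scal_l.
set (a := inner (resolvent T (k + m)%C z) t) in *.
replace a with (/ RtoC (2 * PI) * (RtoC (2 * PI) * a))%C by (field; exact Hpi).
rewrite E; ring.
Qed.

(** The two integrals commute because the resolvents do. *)
Lemma regular_part_kernel z :
  weighted_integral z = zero -> weighted_integral (regular_part z) = zero.
Proof.
intro Hz; unfold regular_part; rewrite (linear_scal _ weighted_integral_linear).
rewrite <- integrals_commute, Hz, (linear_map_zero H _ circle_integral_linear).
vector_ring.
Qed.

Lemma punctured_regular : punctured (fun m => resolvent_set T (k + m)%C).
Proof.
apply (punctured_imp (fun m => 0 < Cmod m < r)); [|apply punctured_lt, r_pos].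
intros m Hm; apply regular; replace (k + m - k)%C with m by ring; lra.
Qed.

(** On this kernel R(k + m) z = S z + m S R(k + m) z with S bounded, so for
    |m| |S| <= 1/2 the second term is absorbed. *)
Lemma resolvent_bounded_on_kernel z : weighted_integral z = zero ->
  exists M, punctured (fun m => norm (resolvent T (k + m)%C z) <= M).
Proof.
intro Hz.
destruct (linear_norm _ regular_part_linear) as [s [Hs Hb]].
exists (2 * (s * norm z)).
assert (Hd : 0 < / (2 * s)) by (apply Rinv_0_lt_compat; lra).
eapply punctured_imp;
  [|exact (punctured_and _ _ punctured_regular (punctured_lt _ Hd))].
intros m [Hl Hm].
pose proof (resolvent_on_kernel m z Hl Hz) as E.
assert (E2 : resolvent T (k + m)%C (regular_part z) =
             regular_part (resolvent T (k + m)%C z)).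
{ unfold regular_part.
  rewrite (linear_scal _ (resolvent_linear H T T_linear _ Hl)).
  rewrite circle_integral_commute by exact Hl; reflexivity. }
rewrite E2 in E.
set (y := resolvent T (k + m)%C z) in *.
assert (Hy : norm y <= norm (regular_part z) + Cmod m * norm (regular_part y)).
{ rewrite E at 1; eapply Rle_trans; [apply norm_plus_le|].
  apply Rplus_le_compat_l, norm_scal_le. }
pose proof (Hb z); pose proof (Hb y); pose proof (norm_ge_0 y).
assert (Cmod m * norm (regular_part y) <= / (2 * s) * (s * norm y)).
{ apply Rmult_le_compat; try apply Cmod_ge_0; try apply norm_ge_0; [lra | assumption]. }
replace (/ (2 * s) * (s * norm y)) with (/ 2 * norm y) in * by (field; lra).
lra.
Qed.

Variable phi : H -> C.
Hypothesis phi_plus : forall x y, dom T x -> dom T y -> phi (plus x y) = (phi x + phi y)%C.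
Hypothesis phi_scal : forall (c : C) x, dom T x -> phi (scal c x) = (c * phi x)%C.
Hypothesis phi_bounded : exists c, 0 <= c /\
  forall x, dom T x -> Cmod (phi x) <= c * (norm x + norm (T x)).

Definition entry (x : H) (m : C) : C := phi (resolvent T (k + m)%C x).

Lemma entry_plus x y : punctured (fun m => entry (plus x y) m = (entry x m + entry y m)%C).
Proof.
eapply punctured_imp; [|exact punctured_regular]; intros m Hl; unfold entry.
rewrite (linear_plus _ (resolvent_linear H T T_linear _ Hl)).
apply phi_plus; apply resolvent_dom; exact Hl.
Qed.

Lemma entry_scal (c : C) x : punctured (fun m => entry (scal c x) m = (c * entry x m)%C).
Proof.
eapply punctured_imp; [|exact punctured_regular]; intros m Hl; unfold entry.
rewrite (linear_scal _ (resolvent_linear H T T_linear _ Hl)).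
apply phi_scal; apply resolvent_dom; exact Hl.
Qed.

Lemma regular_part_dom z : weighted_integral z = zero -> dom T (regular_part z).
Proof.
intro Hz; destruct T_linear as [_ [Dplus [Dscal _]]].
assert (Hl : resolvent_set T (k + RtoC r)%C).
{ apply regular; replace (k + r - k)%C with (RtoC r) by ring.
  rewrite Cmod_R, Rabs_pos_eq by lra; lra. }
pose proof (resolvent_on_kernel (RtoC r) z Hl Hz) as E.
replace (regular_part z) with
  (plus (resolvent T (k + r)%C z)
     (scal (Copp (RtoC r)) (resolvent T (k + r)%C (regular_part z))))
  by (rewrite E at 1; vector_ring).
apply Dplus; [|apply Dscal]; apply resolvent_dom; exact Hl.
Qed.

(** Iterating R(k + m) z = S z + m R(k + m) S z produces one more term of the
    expansion each time, since S z is again in the kernel. *)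
Lemma entry_smooth_on_kernel z : weighted_integral z = zero -> smooth (entry z).
Proof.
intros Hz n; revert z Hz; induction n as [|n IH]; intros z Hz.
- destruct phi_bounded as [c [Hc Hphi]].
  destruct (resolvent_bounded_on_kernel z Hz) as [M HM].
  exists (c * (M + (norm z + (Cmod k + 1) * M))).
  eapply punctured_imp; [|exact (punctured_and _ _ HM
    (punctured_and _ _ punctured_regular (punctured_lt 1 Rlt_0_1)))].
  intros m [Hn [Hl Hm]]; unfold entry.
  apply functional_resolvent_bound; auto.
  eapply Rle_trans; [apply Cmod_triangle|]; lra.
- exists (phi (regular_part z)), (entry (regular_part z)).
  split; [apply IH, regular_part_kernel, Hz|].
  eapply punctured_imp; [|exact punctured_regular]; intros m Hl.
  destruct T_linear as [_ [_ [Dscal _]]]; unfold entry.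
  rewrite (resolvent_on_kernel m z Hl Hz).
  rewrite phi_plus, phi_scal; auto using resolvent_dom, regular_part_dom.
Qed.

(** Any regular point would do; k + r is on the circle. *)
Definition base_resolvent : H -> H := resolvent T (k + r)%C.

(** This is (T - k) (T - k - r)^{-1}, a bounded substitute for T - k. *)
Definition shifted_resolvent (x : H) : H := plus x (scal (RtoC r) (base_resolvent x)).

Lemma base_regular : resolvent_set T (k + r)%C.
Proof.
apply regular; replace (k + r - k)%C with (RtoC r) by ring.
rewrite Cmod_R, Rabs_pos_eq by lra; lra.
Qed.

Lemma base_resolvent_linear : is_linear base_resolvent.
Proof. exact (resolvent_linear H T T_linear _ base_regular). Qed.

Lemma shifted_resolvent_linear : is_linear shifted_resolvent.
Proof.
pose proof base_resolvent_linear as HL; split.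
- intros x y; unfold shifted_resolvent; rewrite (linear_plus _ HL); vector_ring.
- intros c x; unfold shifted_resolvent; rewrite (linear_scal _ HL); vector_ring.
- destruct (linear_norm _ HL) as [b [Hb Hn]]; exists (1 + r * b); split.
  + assert (0 < r * b) by (apply Rmult_lt_0_compat; assumption); lra.
  + intro x; unfold shifted_resolvent.
    eapply Rle_trans; [apply norm_plus_le|].
    pose proof (norm_scal_le H (RtoC r) (base_resolvent x)) as Hs.
    rewrite Cmod_R, Rabs_pos_eq in Hs by lra.
    assert (r * norm (base_resolvent x) <= r * (b * norm x))
      by (apply Rmult_le_compat_l; [lra | apply Hn]).
    lra.
Qed.

Lemma resolvent_base (m : C) x : resolvent_set T (k + m)%C ->
  resolvent T (k + m)%C x =
  plus (base_resolvent x)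
    (scal (m - r)%C (resolvent T (k + m)%C (base_resolvent x))).
Proof.
intro Hl.
rewrite (resolvent_identity H T T_linear _ (k + r)%C x Hl base_regular).
replace (k + m - (k + r))%C with (m - r)%C by ring; reflexivity.
Qed.

Lemma entry_base x : punctured (fun m =>
  entry x m = (phi (base_resolvent x) + (m - r) * entry (base_resolvent x) m)%C).
Proof.
eapply punctured_imp; [|exact punctured_regular]; intros m Hl; unfold entry.
rewrite (resolvent_base m x Hl).
destruct T_linear as [_ [_ [Dscal _]]].
rewrite phi_plus, phi_scal; auto using resolvent_dom, base_regular.
apply resolvent_dom, base_regular.
Qed.

Lemma entry_shifted x : punctured (fun m =>
  entry (shifted_resolvent x) m =
  (phi (base_resolvent x) + m * entry (base_resolvent x) m)%C).
Proof.
eapply punctured_imp; [|exact (punctured_and _ _ (entry_base x) (punctured_and _ _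
  (entry_plus x (scal (RtoC r) (base_resolvent x)))
  (entry_scal (RtoC r) (base_resolvent x))))].
intros m [E1 [E2 E3]]; unfold shifted_resolvent; rewrite E2, E3, E1; ring.
Qed.

(** The vectors N^j L^(d-j) x for j = 0, ..., d, with L the base resolvent and
    N the shifted one.  Being homogeneous in (L, N), their combinations become
    under R(k + m) a polynomial in m times the single vector
    R(k + m) L^d x, because N acts like m L up to terms without R(k + m). *)
Fixpoint homogeneous_orbit (d : nat) (x : H) : list H :=
  match d with
  | O => x :: nil
  | S d' => Nat.iter d base_resolvent x ::
      map shifted_resolvent (homogeneous_orbit d' x)
  end.

Lemma length_homogeneous_orbit d x : length (homogeneous_orbit d x) = S d.
Proof.
induction d as [|d IH]; [reflexivity|]; cbn [homogeneous_orbit length].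
rewrite length_map, IH; reflexivity.
Qed.

Lemma base_homogeneous_orbit d : forall x,
  map base_resolvent (homogeneous_orbit d x) = homogeneous_orbit d (base_resolvent x).
Proof.
assert (Hiter : forall n x, base_resolvent (Nat.iter n base_resolvent x) =
                            Nat.iter n base_resolvent (base_resolvent x)).
{ induction n as [|n IHn]; intro x; [reflexivity|].
  simpl; rewrite IHn; reflexivity. }
induction d as [|d IH]; intro x; [reflexivity|].
cbn [homogeneous_orbit map]; rewrite Hiter, <- IH, !map_map; f_equal.
apply map_ext; intro y; unfold shifted_resolvent.
rewrite (linear_plus _ base_resolvent_linear), (linear_scal _ base_resolvent_linear).
reflexivity.
Qed.

(** Horner's scheme: each factor N contributes a factor m L, and an error term
    that does not involve the resolvent at k + m. *)
Lemma entry_lin_comb_orbit d : forall (a : list C) x, length a = S d ->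
  exists g, smooth g /\ punctured (fun m =>
    entry (lin_comb H a (homogeneous_orbit d x)) m =
    (horner a m * entry (Nat.iter d base_resolvent x) m + g m)%C).
Proof.
induction d as [|d IH]; intros [|c a] x Ha; try discriminate; injection Ha as Ha.
- destruct a; [|discriminate]; exists (fun _ => RtoC 0); split; [apply smooth_const|].
  eapply punctured_imp; [|exact (entry_scal c x)].
  intros m E; cbn [homogeneous_orbit lin_comb].
  assert (E0 : plus (scal c x) (zero : H) = scal c x) by vector_ring.
  rewrite E0, E; simpl; ring.
- cbn [homogeneous_orbit lin_comb horner fold_right].
  rewrite (lin_comb_map H _ a shifted_resolvent_linear).
  set (y := lin_comb H a (homogeneous_orbit d x)).
  destruct (IH a (base_resolvent x) Ha) as [g [Hg Hag]].
  rewrite <- base_homogeneous_orbit, (lin_comb_map H _ a base_resolvent_linear) in Hag.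
  fold y in Hag.
  replace (Nat.iter d base_resolvent (base_resolvent x))
    with (Nat.iter (S d) base_resolvent x) in Hag
    by apply (Nat.iter_succ_r d _ base_resolvent x).
  set (v := Nat.iter (S d) base_resolvent x) in *.
  exists (fun m => (phi (base_resolvent y) + m * g m)%C).
  split; [apply smooth_shift, Hg|].
  eapply punctured_imp; [|exact (punctured_and _ _ Hag
    (punctured_and _ _ (entry_shifted y) (punctured_and _ _ (entry_scal c v)
       (entry_plus (scal c v) (shifted_resolvent y)))))].
  intros m [E1 [E2 [E3 E4]]]; refine (eq_trans E4 _).
  rewrite E3, E2, E1; unfold horner; ring.
Qed.

(** R(k + m) x = L x + (m - r) R(k + m) L x removes the powers of L. *)
Lemma smooth_horner_entry_iter p d : forall x,
  smooth (fun m => (horner p m * entry (Nat.iter d base_resolvent x) m)%C) ->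
  smooth (fun m => (horner p m * entry x m)%C).
Proof.
induction d as [|d IH]; intros x Hs; [exact Hs|].
rewrite Nat.iter_succ_r in Hs; apply IH in Hs.
eapply smooth_ext.
- apply smooth_plus; [exact (smooth_scal (phi (base_resolvent x)) _ (smooth_horner p))|].
  apply smooth_plus; [exact (smooth_shift (RtoC 0) _ Hs)|].
  exact (smooth_scal (Copp (RtoC r)) _ Hs).
- eapply punctured_imp; [|exact (entry_base x)].
  intros m E; simpl; rewrite E; ring.
Qed.

(** Finite rank makes the images under the Riesz projection of a long enough
    homogeneous orbit dependent; the corresponding combination z of the orbit
    itself then lies in the kernel of the projection, where matrix entries of
    the resolvent are known to have expansions to all orders. *)
Theorem entry_meromorphic x : finite_rank (riesz_projection T k r) ->
  exists p : list C, Exists (fun a => a <> RtoC 0) p /\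
    smooth (fun m => (horner p m * entry x m)%C).
Proof.
intros [n [e Hrank]].
assert (Hspan : List.Forall (in_span H e (S n))
  (map (riesz_projection T k r) (homogeneous_orbit (S n) x))).
{ apply List.Forall_forall; intros y Hy; apply in_map_iff in Hy.
  destruct Hy as [w [<- _]]; destruct (Hrank w) as [c ->].
  apply in_span_sum_n. }
destruct (dependent_of_in_span H e (S n) _
  (eq_trans (length_map _ _) (length_homogeneous_orbit _ _)) Hspan)
  as [a [Ha [Hnz Hdep]]].
rewrite length_map, length_homogeneous_orbit in Ha.
assert (Hlin : is_linear (riesz_projection T k r))
  by exact (is_linear_comp _ _ weighted_integral_linear
    (is_linear_scal_r (V := H) (Copp (Cinv (2 * PI * Ci))) Cmult_comm)).
rewrite (lin_comb_map H _ a Hlin) in Hdep.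
set (z := lin_comb H a (homogeneous_orbit (S n) x)) in *.
assert (Hz : weighted_integral z = zero).
{ assert (Hpi : (2 * PI * Ci)%C <> RtoC 0).
  { assert (RtoC PI <> RtoC 0).
    { intro Hp; apply RtoC_inj in Hp; pose proof PI_RGT_0; lra. }
    repeat apply Cmult_neq_0; try exact Ci_nz; try assumption.
    intro Hp; apply RtoC_inj in Hp; lra. }
  transitivity (scal (Copp (2 * PI * Ci))%C (riesz_projection T k r z)).
  - rewrite riesz_projection_weighted.
    apply inner_ext; intro t; rewrite !inner_scal_l.
    field; split; [exact Ci_nz|].
    intro Hp; apply Hpi; rewrite Hp; ring.
  - rewrite Hdep; vector_ring. }
exists a; split; [exact Hnz|].
apply (smooth_horner_entry_iter a (S n)).
destruct (entry_lin_comb_orbit (S n) a x Ha) as [g [Hg Heq]]; fold z in Heq.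
eapply smooth_ext.
- exact (smooth_plus _ _ (entry_smooth_on_kernel z Hz) (smooth_scal (Copp (RtoC 1)) _ Hg)).
- eapply punctured_imp; [|exact Heq]; intros m E; simpl; rewrite E; simpl; ring.
Qed.

End IsolatedPoint.

(** * Boundary triplets *)

Section Adjoint.

Variables (H : HilbertSpace) (T : operator H H).
Hypothesis T_dense : densely_defined T.

Lemma dense_separates (w w' : H) :
  (forall u, dom T u -> inner u w = inner u w') -> w = w'.
Proof.
intro Heq.
set (z := minus w w').
assert (Hz : forall u, dom T u -> inner u z = RtoC 0).
{ intros u Hu; unfold z; rewrite inner_minus_r, (Heq u Hu); ring. }
assert (Hz0 : inner z z = RtoC 0).
{ apply Cmod_arbitrarily_small with (@norm_factor C_AbsRing H * norm z).
  intros e He.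
  destruct (T_dense z (mkposreal e (proj1 He))) as [u [Hu Hball]].
  apply (norm_compat2 (V := H)) in Hball; simpl in Hball.
  replace (inner z z) with (Copp (inner (minus u z) z)).
  - rewrite Cmod_opp; apply Rle_trans with (1 := cauchy_schwarz H _ _).
    rewrite <- Rmult_assoc; apply Rmult_le_compat_r; [apply norm_ge_0|].
    rewrite Rmult_comm; left; exact Hball.
  - rewrite inner_minus_l, (Hz u Hu); ring. }
apply inner_self_eq_zero in Hz0.
replace w with (plus w' z) by (unfold z; vector_ring).
rewrite Hz0; vector_ring.
Qed.

Lemma adjoint_spec v u : dom (adjoint T) v -> dom T u ->
  inner (T u) v = inner u (adjoint T v).
Proof.
intros [w Hw] Hu; revert u Hu.
refine (iota_correct (fun w => forall u, dom T u -> inner (T u) v = inner u w) _).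
exists w; split; [exact Hw|].
intros w' Hw'; apply dense_separates; intros u Hu.
rewrite <- (Hw u Hu); apply Hw', Hu.
Qed.

Lemma adjoint_unique v w :
  (forall u, dom T u -> inner (T u) v = inner u w) -> adjoint T v = w.
Proof.
intro Hw; apply dense_separates; intros u Hu.
rewrite <- adjoint_spec; auto; exists w; exact Hw.
Qed.

Lemma adjoint_linear : linear_operator (adjoint T).
Proof.
assert (Hplus : forall x y, dom (adjoint T) x -> dom (adjoint T) y ->
  forall u, dom T u ->
  inner (T u) (plus x y) = inner u (plus (adjoint T x) (adjoint T y))).
{ intros x y Hx Hy u Hu; rewrite !inner_plus_r, !adjoint_spec; auto. }
assert (Hscal : forall (a : C) x, dom (adjoint T) x ->
  forall u, dom T u -> inner (T u) (scal a x) = inner u (scal a (adjoint T x))).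
{ intros a x Hx u Hu; rewrite !inner_scal_r, adjoint_spec; auto. }
repeat split.
- exists zero; intros u _.
  rewrite inner_conj, inner_zero_l, (inner_conj zero u), inner_zero_l; reflexivity.
- intros x y Hx Hy; exists (plus (adjoint T x) (adjoint T y)); auto.
- intros a x Hx; exists (scal a (adjoint T x)); auto.
- intros x y Hx Hy; apply adjoint_unique; auto.
- intros a x Hx; apply adjoint_unique; auto.
Qed.

End Adjoint.

Section BoundaryTriplet.

Variables (H E F : HilbertSpace) (A At : operator H H).
Hypothesis At_dense : densely_defined At.
Variables (G1 : H -> E) (G2 : H -> F) (Gt1 : H -> F) (Gt2 : H -> E).
Hypothesis triplet : boundary_triplet A At G1 G2 Gt1 Gt2.
Variable B : F -> E.
Hypothesis B_linear : is_linear B.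

Local Notation Amax := (adjoint At).
Local Notation AB := (A_B At G1 G2 B).
Local Notation bd := (boundary_map G1 G2 B).

Lemma boundary_map_plus x y : dom Amax x -> dom Amax y ->
  bd (plus x y) = plus (bd x) (bd y).
Proof.
intros Hx Hy; unfold boundary_map.
rewrite (proj1 (bt_linear_G1 triplet)), (proj1 (bt_linear_G2 triplet)) by assumption.
rewrite (linear_plus _ B_linear); vector_ring.
Qed.

Lemma boundary_map_scal (a : C) x : dom Amax x -> bd (scal a x) = scal a (bd x).
Proof.
intro Hx; unfold boundary_map.
rewrite (proj2 (bt_linear_G1 triplet)), (proj2 (bt_linear_G2 triplet)) by assumption.
rewrite (linear_scal _ B_linear); vector_ring.
Qed.

Lemma A_B_linear : linear_operator AB.
Proof.
destruct (adjoint_linear H At At_dense) as [D0 [Dplus [Dscal [Splus Sscal]]]].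
split; [|split; [|split; [|split]]].
- split; [exact D0|].
  replace (zero : H) with (scal (RtoC 0) (zero : H)) by vector_ring.
  rewrite boundary_map_scal by exact D0; vector_ring.
- intros x y [Hx Bx] [Hy By]; split; [auto|].
  rewrite boundary_map_plus, Bx, By by assumption; vector_ring.
- intros a x [Hx Bx]; split; [auto|].
  rewrite boundary_map_scal, Bx by assumption; vector_ring.
- intros x y [Hx _] [Hy _]; apply Splus; assumption.
- intros a x [Hx _]; apply Sscal; assumption.
Qed.

(** Subtract from any u with boundary value f the vector of D(A_B) solving
    the inhomogeneous equation; it has boundary value zero. *)
Lemma boundary_range_ker (lam : C) f : resolvent_set AB lam ->
  boundary_range At G1 G2 B f -> exists u, ker (shift Amax lam) u /\ bd u = f.
Proof.
intros Hl [u [Du Hu]].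
destruct (adjoint_linear H At At_dense) as [D0 [Dplus [Dscal [Splus Sscal]]]].
set (w := resolvent AB lam (shift Amax lam u)).
destruct (resolvent_spec H AB lam (shift Amax lam u) Hl) as [[Dw Bw] Ew]; fold w in Dw, Bw, Ew.
change (shift AB lam w) with (shift Amax lam w) in Ew.
exists (plus u (scal (Copp (RtoC 1)) w)); repeat split.
- apply Dplus; auto.
- unfold shift in *; cbn [Defs.app] in *; rewrite Splus, Sscal by auto.
  replace (Amax w) with (plus (minus (Amax u) (scal lam u)) (scal lam w))
    by (rewrite <- Ew; vector_ring).
  vector_ring.
- rewrite boundary_map_plus, boundary_map_scal by auto.
  rewrite Bw, Hu; vector_ring.
Qed.

(** The vector u + (lam - lam0) R(lam) u is the solution at lam with the
    boundary value of u, and there is only one since A_B - lam is injective. *)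
Lemma M_function_resolvent (lam lam0 : C) u :
  resolvent_set AB lam -> ker (shift Amax lam0) u ->
  M_function At G1 G2 B lam (bd u) =
  plus (G2 u) (scal (lam - lam0)%C (G2 (resolvent AB lam u))).
Proof.
intros Hl [Du Eu].
destruct (adjoint_linear H At At_dense) as [D0 [Dplus [Dscal [Splus Sscal]]]].
destruct (resolvent_spec H AB lam u Hl) as [[Dw Bw] Ew].
set (w := resolvent AB lam u) in Dw, Bw, Ew |- *.
change (shift AB lam w) with (shift Amax lam w) in Ew.
assert (Hsol : ker (shift Amax lam) (plus u (scal (lam - lam0)%C w)) /\
               bd (plus u (scal (lam - lam0)%C w)) = bd u).
{ repeat split.
  - apply Dplus; auto.
  - unfold shift in *; cbn [Defs.app] in *; rewrite Splus, Sscal by auto.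
    replace (Amax u) with (scal lam0 u)
      by (transitivity (plus (minus (Amax u) (scal lam0 u)) (scal lam0 u));
          [rewrite Eu|]; vector_ring).
    replace (Amax w) with (plus u (scal lam w)) by (rewrite <- Ew at 1; vector_ring).
    vector_ring.
  - rewrite boundary_map_plus, boundary_map_scal by auto.
    rewrite Bw; vector_ring. }
assert (Huniq : forall v, ker (shift Amax lam) v -> bd v = bd u ->
                  v = plus u (scal (lam - lam0)%C w)).
{ intros v [Dv Ev] Bv; destruct Hsol as [[Dy Ey] By].
  set (y := plus u (scal (lam - lam0)%C w)) in *.
  assert (Hd : plus v (scal (Copp (RtoC 1)) y) = zero).
  { destruct Hl as [Hex _]; destruct (Hex zero) as [z [_ Hz]].
    transitivity z; [symmetry|]; apply Hz; (split; [split|]).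
    - apply Dplus; auto.
    - rewrite boundary_map_plus, boundary_map_scal, Bv, By by auto; vector_ring.
    - change (shift Amax lam (plus v (scal (Copp (RtoC 1)) y)) = zero).
      unfold shift in *; cbn [Defs.app] in *; rewrite Splus, Sscal by auto.
      transitivity (plus (minus (Amax v) (scal lam v))
        (scal (Copp (RtoC 1)) (minus (Amax y) (scal lam y)))); [vector_ring|].
      rewrite Ev, Ey; vector_ring.
    - exact D0.
    - replace (zero : H) with (scal (RtoC 0) (zero : H)) by vector_ring.
      rewrite boundary_map_scal by exact D0; vector_ring.
    - change (shift Amax lam zero = zero).
      unfold shift; cbn [Defs.app].
      replace (zero : H) with (scal (RtoC 0) (zero : H)) at 1 by vector_ring.
      rewrite Sscal by exact D0; vector_ring. }
  replace v with (plus (plus v (scal (Copp (RtoC 1)) y)) y) by vector_ring.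
  rewrite Hd; vector_ring. }
set (y := plus u (scal (lam - lam0)%C w)) in *.
assert (HG : G2 y = plus (G2 u) (scal (lam - lam0)%C (G2 w))).
{ unfold y; rewrite (proj1 (bt_linear_G2 triplet)), (proj2 (bt_linear_G2 triplet));
  auto. }
rewrite <- HG.
assert (Hex : exists! g, exists u', ker (shift Amax lam) u' /\ bd u' = bd u /\ G2 u' = g).
{ exists (G2 y); split; [exists y; tauto|].
  intros g [v [Kv [Bv <-]]]; rewrite (Huniq v Kv Bv); reflexivity. }
destruct (iota_correct _ Hex) as [v [Kv [Bv Gv]]].
rewrite (Huniq v Kv Bv) in Gv; symmetry; exact Gv.
Qed.

Definition boundary_functional (v : F) (u : H) : C := inner (G2 u) v.

Lemma boundary_functional_plus v x y : dom Amax x -> dom Amax y ->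
  boundary_functional v (plus x y) =
  (boundary_functional v x + boundary_functional v y)%C.
Proof.
intros Hx Hy; unfold boundary_functional.
rewrite (proj1 (bt_linear_G2 triplet)) by assumption; apply inner_plus_l.
Qed.

Lemma boundary_functional_scal v (a : C) x : dom Amax x ->
  boundary_functional v (scal a x) = (a * boundary_functional v x)%C.
Proof.
intro Hx; unfold boundary_functional.
rewrite (proj2 (bt_linear_G2 triplet)) by assumption; apply inner_scal_l.
Qed.

Lemma boundary_functional_bounded v : exists c, 0 <= c /\
  forall x, dom Amax x -> Cmod (boundary_functional v x) <= c * (norm x + norm (Amax x)).
Proof.
destruct (bt_bounded_G2 triplet) as [c Hc].
exists (Rabs c * norm v); split.
- apply Rmult_le_pos; [apply Rabs_pos | apply norm_ge_0].
- intros x Hx; unfold boundary_functional.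
  apply Rle_trans with (1 := cauchy_schwarz F _ _).
  rewrite (Rmult_comm (Rabs c)), Rmult_assoc, (Rmult_comm (norm v)).
  apply Rmult_le_compat_r; [apply norm_ge_0|].
  apply Rle_trans with (1 := Hc x Hx).
  assert (Hg : 0 <= graph_norm Amax x <= norm x + norm (Amax x)).
  { split; [apply sqrt_pos|].
    pose proof (norm_ge_0 x); pose proof (norm_ge_0 (Amax x)).
    apply Rsqr_incr_0_var; [|lra]; unfold graph_norm.
    rewrite Rsqr_sqrt; unfold Rsqr; nra. }
  apply Rle_trans with (Rabs c * graph_norm Amax x).
  + apply Rmult_le_compat_r; [apply Hg | apply Rle_abs].
  + apply Rmult_le_compat_l; [apply Rabs_pos | apply Hg].
Qed.

Definition M_entry (k : C) (f : E) (v : F) (m : C) : C :=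
  inner (M_function At G1 G2 B (k + m)%C f) v.

Lemma M_entry_resolvent (k lam0 m : C) u v :
  resolvent_set AB (k + m)%C -> ker (shift Amax lam0) u ->
  M_entry k (bd u) v m =
  (boundary_functional v u +
   (k + m - lam0) * entry H AB k (boundary_functional v) u m)%C.
Proof.
intros Hl Hu; unfold M_entry, entry, boundary_functional.
rewrite (M_function_resolvent _ lam0) by assumption.
rewrite inner_plus_l, inner_scal_l; reflexivity.
Qed.

(** With w a solution at k itself, M_B(k + m) f is Gamma_2 w + m Gamma_2
    R(k + m) w, and the last resolvent stays bounded near k. *)
Lemma M_entry_limit_regular (k u l : C) f v :
  resolvent_set AB k ->
  at_right 0 (fun x : R => resolvent_set AB (k + u * x)%C) ->
  boundary_range At G1 G2 B f -> ray_limit (M_entry k f v) u l ->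
  l = M_entry k f v (RtoC 0).
Proof.
intros Hk Hray Hf Hl.
destruct (boundary_range_ker k f Hk Hf) as [w [Hw <-]].
destruct (boundary_functional_bounded v) as [c [Hc Hphi]].
destruct (linear_norm _ (resolvent_linear H AB A_B_linear k Hk)) as [b [Hb Hn]].
set (K := c * (2 * b * norm w + (norm w + (Cmod k + 1) * (2 * b * norm w)))).
apply (ray_limit_value _ _ _ _ (Cmod u * K) Hl).
assert (Hsmall : at_right 0 (fun x : R => 0 < x /\ Cmod (u * x) <= 1 /\
    Cmod (u * x) * b <= / 2)).
{ pose proof (Cmod_ge_0 u).
  assert (Hd : 0 < / ((Cmod u + 1) * (1 + 2 * b)))
    by (apply Rinv_0_lt_compat, Rmult_lt_0_compat; lra).
  exists (mkposreal _ Hd); intros x Hx Hx0.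
  change (Rabs (x - 0) < / ((Cmod u + 1) * (1 + 2 * b))) in Hx.
  rewrite Rminus_0_r, Rabs_pos_eq in Hx by lra.
  rewrite Cmod_mult, Cmod_R, Rabs_pos_eq by lra.
  assert (Hux : Cmod u * x * (1 + 2 * b) <= 1).
  { apply Rle_trans with ((Cmod u + 1) * / ((Cmod u + 1) * (1 + 2 * b)) * (1 + 2 * b)).
    - apply Rmult_le_compat_r; [lra|]; apply Rmult_le_compat; lra.
    - right; field; lra. }
  assert (0 <= Cmod u * x) by (apply Rmult_le_pos; lra).
  assert (0 <= Cmod u * x * b) by (apply Rmult_le_pos; lra).
  repeat split; lra. }
eapply filter_imp; [|exact (filter_and _ _ Hray Hsmall)].
intros x [Hreg [Hx [Hx1 Hxb]]].
assert (Hk0 : resolvent_set AB (k + RtoC 0)%C)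
  by (replace (k + 0)%C with k by ring; exact Hk).
rewrite !(M_entry_resolvent k k) by assumption.
replace (boundary_functional v w + (k + u * x - k) *
    entry H AB k (boundary_functional v) w (u * x) -
  (boundary_functional v w + (k + 0 - k) *
    entry H AB k (boundary_functional v) w 0))%C
  with ((u * x) * entry H AB k (boundary_functional v) w (u * x)%C)%C by ring.
rewrite !Cmod_mult, Cmod_R, Rabs_pos_eq by lra.
replace (Cmod u * K * x) with (Cmod u * x * K) by ring.
apply Rmult_le_compat_l; [apply Rmult_le_pos; [apply Cmod_ge_0 | lra]|].
apply (functional_resolvent_bound H AB); auto.
- intros y [Hy _]; exact (Hphi y Hy).
- apply (resolvent_bound_near H AB A_B_linear k); auto.
  replace (k + u * x - k)%C with (u * x)%C by ring; exact Hxb.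
- eapply Rle_trans; [apply Cmod_triangle|]; lra.
Qed.

(** With w a solution at k + r, the entry of M_B is a constant plus m - r times
    the entry of the resolvent at w, so it has at most a pole at k. *)
Lemma M_entry_limits_isolated (k u u' l l' : C) (r : R) f v :
  0 < r -> (forall lam : C, 0 < Cmod (lam - k) <= r -> resolvent_set AB lam) ->
  finite_rank (riesz_projection AB k r) ->
  u <> RtoC 0 -> u' <> RtoC 0 -> boundary_range At G1 G2 B f ->
  ray_limit (M_entry k f v) u l -> ray_limit (M_entry k f v) u' l' ->
  l = l'.
Proof.
intros Hr Hreg Hrank Hu Hu' Hf Hl Hl'.
destruct (boundary_range_ker _ f (base_regular H AB k r Hr Hreg) Hf) as [w [Hw <-]].
set (phi := boundary_functional v).
destruct (entry_meromorphic H AB A_B_linear k r Hr Hreg phi) with (x := w)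
  as [p [Hp Hs]]; auto.
- intros x y [Hx _] [Hy _]; apply boundary_functional_plus; assumption.
- intros a x [Hx _]; apply boundary_functional_scal; assumption.
- destruct (boundary_functional_bounded v) as [c [Hc Hphi]].
  exists c; split; [exact Hc|]; intros x [Hx _]; exact (Hphi x Hx).
- refine (ray_limits_agree p _ u u' l l' Hp Hu Hu' Hl Hl' _).
  assert (Hsm : smooth (fun m => (horner p m * M_entry k (bd w) v m)%C));
    [|apply Hsm].
  eapply smooth_ext.
  + apply smooth_plus; [exact (smooth_scal (phi w) _ (smooth_horner p))|].
    apply smooth_plus; [exact (smooth_shift (RtoC 0) _ Hs)|].
    exact (smooth_scal (Copp (RtoC r)) _ Hs).
  + eapply punctured_imp; [|exact (punctured_regular H AB k r Hr Hreg)].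
    intros m Hm; simpl.
    rewrite (M_entry_resolvent k (k + r)) by assumption; fold phi; ring.
Qed.

Lemma weak_limit_ray (k u : C) (g : R -> F) f v (y : F) :
  (forall x : R, g x = M_function At G1 G2 B (k + u * x)%C f) ->
  weak_limit_at_0 g y -> ray_limit (M_entry k f v) u (inner y v).
Proof.
intros Hg Hlim e He; specialize (Hlim v).
apply (filterlim_locally_ball_norm (F := at_right 0) (U := C_NormedModule))
  with (eps := mkposreal e He) in Hlim.
eapply filter_imp; [|exact Hlim]; intros x Hx.
change (Cmod (inner (g x) v - inner y v) < e) in Hx.
unfold M_entry; rewrite <- Hg; exact Hx.
Qed.

End BoundaryTriplet.

Theorem proposition5p3
  (H E F : HilbertSpace)
  (A At : operator H H)
  (linear_A : linear_operator A) (linear_At : linear_operator At)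
  (closed_A : closed_operator A) (closed_At : closed_operator At)
  (dense_A : densely_defined A) (dense_At : densely_defined At)
  (pair_A_At : adjoint_pair A At)
  (G1 : H -> E) (G2 : H -> F) (Gt1 : H -> F) (Gt2 : H -> E)
  (triplet : boundary_triplet A At G1 G2 Gt1 Gt2)
  (B : F -> E) (bounded_B : is_linear B)
  (k : C)
  (resolvent_near_k :
    exists eps0 : R, 0 < eps0 /\
      forall eps : R, 0 < eps < eps0 ->
        resolvent_set (A_B At G1 G2 B) (k + Ci * eps) /\
        resolvent_set (A_B At G1 G2 B) (k - Ci * eps))
  (ucp : unique_continuation (adjoint At) k G1 G2)
  (ucp_tilde : unique_continuation (adjoint A) (Cconj k) Gt1 Gt2)
  (M_plus M_minus : E -> F)
  (weak_limit_plus : forall g, boundary_range At G1 G2 B g ->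
    weak_limit_at_0 (fun eps => M_function At G1 G2 B (k + Ci * eps) g)
                    (M_plus g))
  (weak_limit_minus : forall g, boundary_range At G1 G2 B g ->
    weak_limit_at_0 (fun eps => M_function At G1 G2 B (k - Ci * eps) g)
                    (M_minus g))
  (jump : exists f, boundary_range At G1 G2 B f /\ M_plus f <> M_minus f) :
  essential_spectrum (A_B At G1 G2 B) k.
Proof.
destruct jump as [f [Hf Hjump]].
assert (Hray : forall v,
  ray_limit (M_entry H E F At G1 G2 B k f v) Ci (inner (M_plus f) v) /\
  ray_limit (M_entry H E F At G1 G2 B k f v) (Copp Ci) (inner (M_minus f) v)).
{ intro v; split.
  - refine (weak_limit_ray H E F At G1 G2 B k Ci _ f v _ _ (weak_limit_plus f Hf)).
    reflexivity.
  - refine (weak_limit_ray H E F At G1 G2 B k (Copp Ci) _ f v _ _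
      (weak_limit_minus f Hf)).
    intro x; f_equal; ring. }
split.
- intro Hk; apply Hjump, inner_ext; intro v.
  destruct (Hray v) as [Hp Hm], resolvent_near_k as [e [He Hres]].
  assert (Hnear : at_right 0 (fun x : R => 0 < x < e)).
  { exists (mkposreal e He); intros x Hx Hx0.
    change (Rabs (x - 0) < e) in Hx; rewrite Rminus_0_r in Hx.
    pose proof (Rle_abs x); lra. }
  transitivity (M_entry H E F At G1 G2 B k f v (RtoC 0)); [|symmetry].
  + refine (M_entry_limit_regular H E F A At dense_At G1 G2 Gt1 Gt2 triplet B
      bounded_B k Ci _ f v Hk _ Hf Hp).
    eapply filter_imp; [|exact Hnear]; intros x Hx; apply (Hres x Hx).
  + refine (M_entry_limit_regular H E F A At dense_At G1 G2 Gt1 Gt2 triplet B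
      bounded_B k (Copp Ci) _ f v Hk _ Hf Hm).
    eapply filter_imp; [|exact Hnear]; intros x Hx.
    replace (k + - Ci * x)%C with (k - Ci * x)%C by ring; apply (Hres x Hx).
- intros [_ [r [Hr [Hreg Hrank]]]]; apply Hjump, inner_ext; intro v.
  destruct (Hray v) as [Hp Hm].
  apply (M_entry_limits_isolated H E F A At dense_At G1 G2 Gt1 Gt2 triplet B
    bounded_B k Ci (Copp Ci) _ _ r f v Hr Hreg Hrank); auto.
  + exact Ci_nz.
  + intro H0; apply Ci_nz; replace Ci with (Copp (Copp Ci)) by ring.
    rewrite H0; ring.
Qed.
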